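(* Let $n\ge2$, $0<\mu\le2$ and $$G_\mu:=\Big\{z\in\mathbb{D}^n:\operatorname{Re}z_1<\sum_{j=2}^n|z_j|^\mu\Big\},\qquad \tilde G_\mu:=\Big\{z\in\mathbb{D}^n:\operatorname{Re}z_1<|\operatorname{Im}z_1|^\mu+\sum_{j=2}^n|z_j|^\mu\Big\}.$$ For $t\in(0,1)$ let $p_t:=(-t,0)\in\mathbb{C}\times\mathbb{C}^{n-1}$. Let $0<\delta<\varepsilon\le\frac12$ and $2\le m\le\infty$. Then $$\ell_{G_\mu}(p_\delta,p_\varepsilon)\asymp\ell_{\tilde G_\mu}(p_\delta,p_\varepsilon)\asymp\frac{\varepsilon-\delta}{\varepsilon^{(1-\frac1{2\mu})_+}}\ \ge\ \frac{\varepsilon-\delta}{\varepsilon^{(1-\frac1\mu)_+}}\asymp\ell^{(m)}_{G_\mu}(p_\delta,p_\varepsilon)\asymp\ell^{(m)}_{\tilde G_\mu}(p_\delta,p_\varepsilon).$$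
   Context: $\mathbb{D}$ is the open unit disc in $\mathbb{C}$, $\mathcal{O}(\mathbb{D},M)$ is the set of holomorphic maps $\mathbb{D}\to M$, and $x_+:=\max(x,0)$ for $x\in\mathbb{R}$. For a domain $M\subset\mathbb{C}^n$ and $z,w\in M$: $\ell_M(z,w):=\inf\{|\alpha|:\alpha\in\mathbb{D},\ \exists\varphi\in\mathcal{O}(\mathbb{D},M),\ \varphi(0)=z,\ \varphi(\alpha)=w\}$; for a positive integer $m$, $\ell_M^{(m)}(z,w):=\inf\{\sum_{j=0}^{m-1}\ell_M(y_j,y_{j+1}):y_0,\dots,y_m\in M,\ y_0=z,\ y_m=w\}$; and $\ell_M^{(\infty)}:=\inf_{m\ge1}\ell_M^{(m)}$. $A\asymp B$ means that $c^{-1}B\le A\le cB$ for a constant $c>0$ independent of $\delta$ and $\varepsilon$. *)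

(* Defs.v *)
From HB Require Import structures.
From mathcomp Require Import all_boot all_order all_algebra complex.
From mathcomp Require Import all_classical all_reals all_analysis.

Set Implicit Arguments.
Unset Strict Implicit.
Unset Printing Implicit Defensive.

Import Order.TTheory GRing.Theory Num.Theory.
Import numFieldNormedType.Exports.
Import ComplexField.Normc.

Local Open Scope classical_set_scope.
Local Open Scope ring_scope.
Local Open Scope complex_scope.

(* Throughout, [normc z : R] is the modulus of [z : R[i]] as a real number
   (the ring norm [`|z|] is the same number, seen in R[i]). *)

Definition disc (R : realType) : set R[i] := [set z | normc z < 1].
Arguments disc {R}.

(* O(D, M). A map D -> M is represented by a total function on R[i], of which
   only the values on D are constrained; R[i]^o is R[i] as a normed module over
   itself, so that derivability in the direction 1 is complex
   differentiability. *)
Definition holomorphic_disc (R : realType) (n : nat) (M : set 'rV[R[i]]_n.+1) :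
    set (R[i] -> 'rV[R[i]]_n.+1) :=
  [set phi | forall z, disc z -> M (phi z) /\
    forall j, derivable (fun x : R[i]^o => phi x 0 j : R[i]^o) z 1].

(* Infima are taken in the extended reals, hence that of the empty set is +oo. *)
Definition lempert (R : realType) (n : nat) (M : set 'rV[R[i]]_n.+1)
    (z w : 'rV[R[i]]_n.+1) : \bar R :=
  ereal_inf [set (normc a)%:E | a in
    [set a : R[i] | disc a /\
      exists phi, [/\ holomorphic_disc M phi, phi 0 = z & phi a = w]]].

Definition lempert_chain (R : realType) (n : nat) (M : set 'rV[R[i]]_n.+1)
    (m : nat) (z w : 'rV[R[i]]_n.+1) : \bar R :=
  ereal_inf [set (\sum_(j < m) lempert M (y j) (y j.+1))%E | y in
    [set y : nat -> 'rV[R[i]]_n.+1 |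
      [/\ forall j, (j <= m)%N -> M (y j), y 0%N = z & y m = w]]].

(* The index [None] stands for infinity. *)
Definition lempert_ext (R : realType) (n : nat) (M : set 'rV[R[i]]_n.+1)
    (m : option nat) (z w : 'rV[R[i]]_n.+1) : \bar R :=
  if m is Some k then lempert_chain M k z w
  else ereal_inf [set lempert_chain M k z w | k in [set k | (1 <= k)%N]].

(* The complex dimension is n.+1; the distinguished coordinate z_1 is
   [z 0 ord0], and z_2, z_3, ... are the [z 0 (lift ord0 j)] with j < n. For
   mu > 0, [0 `^ mu = 0] as expected. *)
Definition G_dom (R : realType) (n : nat) (mu : R) : set 'rV[R[i]]_n.+1 :=
  [set z | (forall j, disc (z 0 j)) /\
    complex.Re (z 0 ord0) < \sum_(j < n) normc (z 0 (lift ord0 j)) `^ mu].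
Arguments G_dom {R} n mu.

Definition Gt_dom (R : realType) (n : nat) (mu : R) : set 'rV[R[i]]_n.+1 :=
  [set z | (forall j, disc (z 0 j)) /\
    complex.Re (z 0 ord0) <
      `|complex.Im (z 0 ord0)| `^ mu
      + \sum_(j < n) normc (z 0 (lift ord0 j)) `^ mu].
Arguments Gt_dom {R} n mu.

Definition pt (R : realType) (n : nat) (t : R) : 'rV[R[i]]_n.+1 :=
  \row_j (if j == ord0 then (- t)%:C else 0).
Arguments pt {R} n t.

Definition pos_part (R : realType) (x : R) : R := Num.max x 0.

(* A and B are comparable on S, with a constant independent of the point of S. *)
Definition asymp (R : realType) (S : R -> R -> Prop) (A B : R -> R -> \bar R) :
    Prop :=
  exists2 c : R, 0 < c & forall x y : R, S x y ->
    (c^-1%:E * B x y <= A x y)%E /\ (A x y <= c%:E * B x y)%E.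

(* Main.v *)
Require Import Defs.
From HB Require Import structures.
From mathcomp Require Import all_boot all_order all_algebra complex.
From mathcomp Require Import all_classical all_reals all_analysis.
From mathcomp Require Import ring lra zify.

Import Order.TTheory GRing.Theory Num.Theory.
Import numFieldNormedType.Exports.
Import ComplexField.Normc.

(** Both invariants decrease when the domain grows, so every comparison follows
    from upper bounds obtained with explicit discs in the smaller domain G and
    from lower bounds valid in the larger domain G~.

    Lower bounds.  Let phi be a holomorphic disc in G~.  When the coordinates
    phi_2, ..., phi_n satisfy |phi_j|^mu = O(eps) on a disc of radius r, the
    function phi_1 omits there a real ray [A, +oo[ with A = O(eps): at a real
    value of phi_1 the term |Im phi_1|^mu vanishes.  The square root of A - phi_1
    then maps into a half-plane, and the Schwarz lemma bounds
    |phi_1 a - phi_1 0| by a constant times (|a| / r) |A - phi_1 0|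
    ([slit_bound], [Gt_dom_disc_bound]).  The exponents come from the size of r.
    For a single disc through p_delta and p_eps the other coordinates vanish at
    both parameters, hence are O(|z| |z - a|), and r can be of order
    eps^(1/(2 mu)) ([lempert_Gt_dom_ge]).  For one link of a chain they are only
    Lipschitz, and r is of order eps^(1/mu); along a short chain the distance
    from the first coordinate to A stays comparable to eps by a discrete Gronwall
    argument, and the links add up ([lempert_chain_Gt_dom_ge]).  When the
    exponent of eps is zero, the Schwarz lemma for phi_1 suffices.

    Upper bounds.  The disc (- delta - s z, z (z - a) / 2) has the required second
    zero at a = (eps - delta) / s; it lies in G for s of order
    eps^((1 - 1/(2 mu))_+) as long as mu <= 1 or delta and eps are comparable.
    When mu > 1 and delta is much smaller than eps, the first coordinate must
    leave p_delta to second order, and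
    (- delta - (eps - delta) z^2 / a^2, z (z - a) / 2) is used instead; this is
    where mu <= 2 matters ([lempert_G_dom_le]).  With two discs the second
    coordinate needs only one zero on each, which gives the smaller bound
    ([lempert_chain_G_dom_le]).  Whenever the parameter produced by these recipes
    is not below 1, the trivial bound 1 is already good enough.

    The Schwarz lemma is needed for functions that are merely complex derivable
    at every point.  It is derived from a weak Cauchy estimate, where constants
    are allowed to be lost: contour integrals are replaced by midpoint sums over
    the boundary of a square, which are additive under dyadic subdivision and
    vanish on affine functions, so that Goursat's bisection applies to them
    ([goursat], [cauchy_bound]). *)

Local Open Scope ring_scope.
Local Open Scope complex_scope.

Set Implicit Arguments.
Unset Strict Implicit.
Unset Printing Implicit Defensive.

(** * Complex derivability in terms of the modulus *)

Lemma normcE (R : realType) (z : R[i]) : `|z| = (normc z)%:C.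
Proof. by case: z. Qed.

Lemma normc_ge0 (R : realType) (z : R[i]) : 0 <= normc z.
Proof. by case: z => a b; rewrite sqrtr_ge0. Qed.

Lemma normc_eq0 (R : realType) (z : R[i]) : (normc z == 0) = (z == 0).
Proof.
by apply/eqP/eqP => [/eq0_normc//|->]; rewrite normc0.
Qed.

Lemma normc_gt0 (R : realType) (z : R[i]) : (0 < normc z) = (z != 0).
Proof. by rewrite lt_neqAle normc_ge0 andbT eq_sym normc_eq0. Qed.

Lemma normcD (R : realType) (z w : R[i]) : normc (z + w) <= normc z + normc w.
Proof. exact: le_normcD. Qed.

Lemma normcB (R : realType) (z w : R[i]) : normc (z - w) = normc (w - z).
Proof. by rewrite -normcN opprB. Qed.

Lemma normc_real (R : realType) (x : R) : normc x%:C = `|x|.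
Proof. by rewrite /= expr0n addr0 sqrtr_sqr. Qed.

Lemma normc_Re (R : realType) (z : R[i]) : `|complex.Re z| <= normc z.
Proof. by have := normc_ge_Re z; rewrite normcE lecR. Qed.

Lemma normc_Im (R : realType) (z : R[i]) : `|complex.Im z| <= normc z.
Proof.
have := normc_Re (z * 'i); rewrite ReiNIm normrN normcM.
suff -> : normc ('i : R[i]) = 1 by rewrite mulr1.
by rewrite /= expr0n expr1n add0r sqrtr1.
Qed.

Lemma normci (R : realType) : normc ('i : R[i]) = 1.
Proof. by rewrite /= expr0n expr1n add0r sqrtr1. Qed.

Lemma normc_Re_Im (R : realType) (z : R[i]) :
  normc z <= `|complex.Re z| + `|complex.Im z|.
Proof.
rewrite [z in normc z]complexE (le_trans (normcD _ _)) //.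
by rewrite normcM normci mul1r !normc_real.
Qed.

(** Neighbourhoods in R[i] are balls with radius in R[i]; this trades them for
    real radii, so that all estimates below take place in R. *)
Lemma nbhs_normc (R : realType) (p : R[i]^o) (P : R[i] -> Prop) :
  (\forall w \near p, P w) <->
  exists2 d : R, 0 < d & forall w : R[i], normc (w - p) < d -> P w.
Proof.
split.
  move=> /nbhs_ballP [d /= d0 H].
  have [dr dE] : exists dr : R, d = dr%:C.
    by exists (complex.Re d); rewrite RRe_real // gtr0_real.
  subst d; exists dr; first by rewrite ltcR in d0.
  move=> w wp; apply: H.
  by rewrite /ball /= normcE ltcR normcB.
move=> [d d0 H]; apply/nbhs_ballP; exists d%:C; first by rewrite /= ltcR.
move=> w; rewrite /ball /= normcE ltcR => wp; apply: H.
by rewrite normcB.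
Qed.

Definition cderivable (R : realType) (f : R[i] -> R[i]) (p : R[i]) : Prop :=
  derivable (f : R[i]^o -> R[i]^o) (p : R[i]^o) 1.

Lemma cderivable_cst (R : realType) (c p : R[i]) : cderivable (fun=> c) p.
Proof. exact: derivable_cst. Qed.

Lemma cderivable_id (R : realType) (p : R[i]) : cderivable id p.
Proof. exact: derivable_id. Qed.

Arguments cderivable_cst {R} c p.
Arguments cderivable_id {R} p.

Lemma cderivableD (R : realType) (f g : R[i] -> R[i]) (p : R[i]) :
  cderivable f p -> cderivable g p -> cderivable (fun w => f w + g w) p.
Proof. exact: (@derivableD R[i] R[i]^o R[i]^o f g p 1). Qed.

Lemma cderivableB (R : realType) (f g : R[i] -> R[i]) (p : R[i]) :
  cderivable f p -> cderivable g p -> cderivable (fun w => f w - g w) p.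
Proof. exact: (@derivableB R[i] R[i]^o R[i]^o f g p 1). Qed.

Lemma cderivableM (R : realType) (f g : R[i] -> R[i]) (p : R[i]) :
  cderivable f p -> cderivable g p -> cderivable (fun w => f w * g w) p.
Proof. exact: (@derivableM R[i] R[i]^o f g p 1). Qed.

Lemma cderivableV (R : realType) (f : R[i] -> R[i]) (p : R[i]) :
  f p != 0 -> cderivable f p -> cderivable (fun w => (f w)^-1) p.
Proof. exact: (@derivableV R[i] R[i]^o f p 1). Qed.

Definition ccontinuous (R : realType) (f : R[i] -> R[i]) (p : R[i]) : Prop :=
  {for p, continuous (f : R[i]^o -> R[i]^o)}.

Lemma cderivable_continuous (R : realType) (f : R[i] -> R[i]) (p : R[i]) :
  cderivable f p -> ccontinuous f p.
Proof. by move=> /derivable1_diffP /differentiable_continuous. Qed.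

Lemma near_eq_cderivable (R : realType) (f g : R[i] -> R[i]) (p : R[i]) (d : R) :
  0 < d -> (forall w, normc (w - p) < d -> f w = g w) ->
  cderivable f p -> cderivable g p.
Proof.
move=> d0 fg; apply: near_eq_derivable.
by apply/nbhs_normc; exists d.
Qed.

Lemma cderivable_normc (R : realType) (f : R[i] -> R[i]) (p : R[i]) :
  cderivable f p -> exists b : R[i], forall e : R, 0 < e ->
  exists2 d : R, 0 < d & forall w, normc (w - p) < d ->
  normc (f w - f p - b * (w - p)) <= e * normc (w - p).
Proof.
move=> /cvg_ex[b /= df]; exists b => e e0.
have e0' : 0 < e%:C by rewrite ltcR.
move/cvgr_dist_le : df => /(_ _ e0') /=; rewrite near_withinE => df.
have /nbhs_normc [d d0 H] := df.
exists d => // w wp; have [->|wNp] := eqVneq w p.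
  by rewrite !subrr mulr0 subr0 normc0 mulr0.
have hN : w - p != 0 by rewrite subr_eq0.
move: H => /(_ (w - p)); rewrite subr0 => /(_ wp hN).
rewrite normcE lecR /GRing.scale /= mulr1 subrK => H.
rewrite -ler_pdivrMr ?normc_gt0 // -normcV -normcM (le_trans _ H) //.
rewrite normcB mulrBl mulfK //.
by rewrite [_ / _]mulrC.
Qed.

Lemma ccontinuous_normc (R : realType) (f : R[i] -> R[i]) (p : R[i]) (e : R) :
  ccontinuous f p -> 0 < e ->
  exists2 d : R, 0 < d & forall w, normc (w - p) < d -> normc (f w - f p) <= e.
Proof.
move=> cf e0; have e0' : 0 < e%:C by rewrite ltcR.
have aux (g : R[i]^o -> R[i]^o) (q : R[i]) : {for q, continuous g} ->
    exists2 d : R, 0 < d & forall w, normc (w - q) < d -> normc (g w - g q) <= e.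
  move/cvgr_dist_le => /(_ _ e0') /nbhs_normc[d d0 H].
  by exists d => // w /H; rewrite normcE lecR normcB.
exact: (aux f p cf).
Qed.

Lemma normc_ccontinuous (R : realType) (f : R[i] -> R[i]) (p : R[i]) :
  (forall e : R, 0 < e ->
    exists2 d : R, 0 < d & forall w, normc (w - p) < d -> normc (f w - f p) <= e) ->
  ccontinuous f p.
Proof.
have aux (g : R[i]^o -> R[i]^o) (q : R[i]^o) : (forall e : R, 0 < e ->
      exists2 d : R, 0 < d & forall w, normc (w - q) < d -> normc (g w - g q) <= e) ->
    {for q, continuous g}.
  move=> H; apply/(@cvgrPdist_le _ _ _ (nbhs q) _) => e e0.
  have eE : e = (complex.Re e)%:C by rewrite RRe_real // gtr0_real.
  rewrite eE; rewrite eE ltcR in e0; have [d d0 Hd] := H _ e0.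
  by apply/nbhs_normc; exists d => // w /Hd; rewrite normcE lecR normcB.
exact: (aux f p).
Qed.

Lemma near_eq_ccontinuous (R : realType) (f g : R[i] -> R[i]) (p : R[i]) (d : R) :
  0 < d -> (forall w, normc (w - p) < d -> f w = g w) ->
  ccontinuous f p -> ccontinuous g p.
Proof.
move=> d0 fg cf; apply: normc_ccontinuous => e /(ccontinuous_normc cf)[d' d'0 H].
exists (Num.min d d') => [|w]; first by rewrite lt_min d0.
rewrite lt_min => /andP[wd wd']; rewrite -fg // -fg ?subrr ?normc0 //.
exact: H.
Qed.

Lemma ccontinuousM (R : realType) (f g : R[i] -> R[i]) (p : R[i]) :
  ccontinuous f p -> ccontinuous g p -> ccontinuous (fun w => f w * g w) p.
Proof. by move=> cf cg; exact: (cvgM cf cg). Qed.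

Lemma ccontinuousB (R : realType) (f g : R[i] -> R[i]) (p : R[i]) :
  ccontinuous f p -> ccontinuous g p -> ccontinuous (fun w => f w - g w) p.
Proof. by move=> cf cg; exact: (cvgB cf cg). Qed.

Lemma ccontinuousD (R : realType) (f g : R[i] -> R[i]) (p : R[i]) :
  ccontinuous f p -> ccontinuous g p -> ccontinuous (fun w => f w + g w) p.
Proof. by move=> cf cg; exact: (cvgD cf cg). Qed.

Lemma ccontinuousV (R : realType) (f : R[i] -> R[i]) (p : R[i]) :
  f p != 0 -> ccontinuous f p -> ccontinuous (fun w => (f w)^-1) p.
Proof. by move=> f0 cf; exact: (cvgV f0 cf). Qed.

Lemma cderivableP (R : realType) (f : R[i] -> R[i]) (p : R[i]) :
  cderivable f p <-> derivable (f : R[i]^o -> R[i]^o) (p : R[i]^o) 1.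
Proof. by []. Qed.

(* Kept opaque so that two derivability statements are never compared through
   the filters that define them. *)
#[global] Opaque cderivable ccontinuous.

(** * Midpoint sums along segments and around squares *)

(** Riemann sum of f over the segment from z to z + v, cut into 2^N pieces.
    The recursion makes additivity under halving hold by computation, and the
    midpoint rule is exact on affine functions. *)
Fixpoint midpoint_sum (R : realType) (f : R[i] -> R[i]) (N : nat) (z v : R[i]) :
    R[i] :=
  if N is N'.+1
  then midpoint_sum f N' z (v / 2) + midpoint_sum f N' (z + v / 2) (v / 2)
  else v * f (z + v / 2).

Lemma midpoint_sum_rev (R : realType) (f : R[i] -> R[i]) N (z v : R[i]) :
  midpoint_sum f N (z + v) (- v) = - midpoint_sum f N z v.
Proof.
elim: N z v => [|N IH] z v /=.
  by rewrite mulNr; congr (- (_ * f _)); field.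
rewrite opprD -!IH addrC.
by congr (midpoint_sum f N _ _ + midpoint_sum f N _ _); field.
Qed.

Lemma eq_midpoint_sum (R : realType) (f g : R[i] -> R[i]) N (z v : R[i]) :
  (forall t : R, 0 <= t <= 1 -> f (z + t%:C * v) = g (z + t%:C * v)) ->
  midpoint_sum f N z v = midpoint_sum g N z v.
Proof.
elim: N z v => [|N IH] z v fg /=.
  have -> : v / 2 = (2^-1 : R)%:C * v by rewrite fmorphV rmorph_nat mulrC.
  by rewrite fg //; lra.
congr (_ + _); apply: IH => t t01.
  have -> : t%:C * (v / 2) = (t / 2)%:C * v.
    by rewrite rmorphM fmorphV rmorph_nat mulrAC mulrA.
  by rewrite fg //; lra.
have -> : z + v / 2 + t%:C * (v / 2) = z + ((1 + t) / 2)%:C * v.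
  by rewrite rmorphM fmorphV rmorph_nat rmorphD rmorph1; field.
by rewrite fg //; lra.
Qed.

Lemma midpoint_sumB (R : realType) (f g : R[i] -> R[i]) N (z v : R[i]) :
  midpoint_sum (fun w => f w - g w) N z v =
  midpoint_sum f N z v - midpoint_sum g N z v.
Proof.
elim: N z v => [|N IH] z v /=; first by rewrite mulrBr.
by rewrite !IH; ring.
Qed.

Lemma midpoint_sumZ (R : realType) (c : R[i]) (f : R[i] -> R[i]) N (z v : R[i]) :
  midpoint_sum (fun w => c * f w) N z v = c * midpoint_sum f N z v.
Proof.
elim: N z v => [|N IH] z v /=; first by rewrite mulrCA.
by rewrite !IH mulrDr.
Qed.

Lemma midpoint_sum_affine (R : realType) (a b : R[i]) N (z v : R[i]) :
  midpoint_sum (fun w => a + b * w) N z v = v * (a + b * (z + v / 2)).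
Proof. by elim: N z v => [|N IH] z v //=; rewrite !IH; field. Qed.

Lemma half_segment (R : realType) (P : R[i] -> Prop) (z v : R[i]) :
  (forall t : R, 0 <= t <= 1 -> P (z + t%:C * v)) ->
  (forall t : R, 0 <= t <= 1 -> P (z + t%:C * (v / 2))) /\
  (forall t : R, 0 <= t <= 1 -> P (z + v / 2 + t%:C * (v / 2))).
Proof.
move=> H; split=> t t01.
  have -> : t%:C * (v / 2) = (t / 2)%:C * v.
    by rewrite rmorphM fmorphV rmorph_nat mulrAC mulrA.
  by apply: H; lra.
have -> : z + v / 2 + t%:C * (v / 2) = z + ((1 + t) / 2)%:C * v.
  by rewrite rmorphM fmorphV rmorph_nat rmorphD rmorph1; field.
by apply: H; lra.
Qed.

Lemma midpoint_sum_norm (R : realType) (f : R[i] -> R[i]) N (M : R) (z v : R[i]) :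
  (forall t : R, 0 <= t <= 1 -> normc (f (z + t%:C * v)) <= M) ->
  normc (midpoint_sum f N z v) <= normc v * M.
Proof.
elim: N z v => [|N IH] z v fM /=.
  rewrite normcM ler_wpM2l ?normc_ge0 //.
  have -> : v / 2 = (2^-1 : R)%:C * v by rewrite fmorphV rmorph_nat mulrC.
  by apply: fM; lra.
have [f1 f2] := half_segment (P := fun w => normc (f w) <= M) fM.
rewrite (le_trans (normcD _ _)) //.
have := IH _ _ f1; have := IH _ _ f2.
have -> : normc (v / 2) = normc v / 2.
  by rewrite normcM normcV -(rmorph_nat (real_complex R)) normc_real ger0_norm.
lra.
Qed.

(** The increment v is kept inside the hypothesis because it carries the
    direction of the segment: for a Cauchy kernel, v / (w - z0) has positive
    imaginary part along a positively oriented contour. *)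
Lemma midpoint_sum_Im (R : realType) (f : R[i] -> R[i]) N (m : R) (z v : R[i]) :
  (forall t : R, 0 <= t <= 1 -> m <= complex.Im (v * f (z + t%:C * v))) ->
  m <= complex.Im (midpoint_sum f N z v).
Proof.
elim: N z v m => [|N IH] z v m fM /=.
  have -> : v / 2 = (2^-1 : R)%:C * v by rewrite fmorphV rmorph_nat mulrC.
  by apply: fM; lra.
have [f1 f2] := half_segment (P := fun w => m <= complex.Im (v * f w)) fM.
have E (w : R[i]) : complex.Im (v / 2 * f w) = complex.Im (v * f w) / 2.
  rewrite mulrAC -(rmorph_nat (real_complex R)) -fmorphV.
  by case: (v * f w) => a b /=; ring.
have /IH H1 : forall t : R, 0 <= t <= 1 ->
    m / 2 <= complex.Im (v / 2 * f (z + t%:C * (v / 2))).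
  by move=> t /f1; rewrite E; lra.
have /IH H2 : forall t : R, 0 <= t <= 1 ->
    m / 2 <= complex.Im (v / 2 * f (z + v / 2 + t%:C * (v / 2))).
  by move=> t /f2; rewrite E; lra.
move: H1 H2; case: (midpoint_sum _ _ _ _) => a b; case: (midpoint_sum _ _ _ _) => c d /=.
lra.
Qed.

Definition in_square (R : realType) (z : R[i]) (L : R) (w : R[i]) : Prop :=
  complex.Re z <= complex.Re w <= complex.Re z + L /\
  complex.Im z <= complex.Im w <= complex.Im z + L.

Definition on_frame (R : realType) (z : R[i]) (L : R) (w : R[i]) : Prop :=
  in_square z L w /\
  [|| complex.Re w == complex.Re z, complex.Re w == complex.Re z + L,
      complex.Im w == complex.Im z | complex.Im w == complex.Im z + L].

(** Stands for the contour integral over the positively oriented boundary of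
    the square with lower left corner z and side L. *)
Definition frame_sum (R : realType) (f : R[i] -> R[i]) N (z : R[i]) (L : R) :=
  midpoint_sum f N z L%:C + midpoint_sum f N (z + L%:C) ('i * L%:C)
  + midpoint_sum f N (z + L%:C + 'i * L%:C) (- L%:C)
  + midpoint_sum f N (z + 'i * L%:C) (- ('i * L%:C)).

Lemma frame_edges (R : realType) (z : R[i]) (L t : R) : 0 <= L -> 0 <= t <= 1 ->
  [/\ on_frame z L (z + t%:C * L%:C),
      on_frame z L (z + L%:C + t%:C * ('i * L%:C)),
      on_frame z L (z + L%:C + 'i * L%:C + t%:C * (- L%:C))
    & on_frame z L (z + 'i * L%:C + t%:C * (- ('i * L%:C)))].
Proof.
move=> L0 /andP[t0 t1]; case: z => a b.
have tL : 0 <= t * L <= L by rewrite mulr_ge0 //= ler_piMl.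
split; rewrite /on_frame /in_square /=;
  rewrite ?(mul0r, mulr0, mul1r, addr0, add0r, subr0, sub0r, oppr0, mulrN) /=.
- by split; [split; lra | rewrite eqxx !orbT].
- by split; [split; lra | rewrite eqxx !orbT].
- by split; [split; lra | rewrite eqxx !orbT].
- by split; [split; lra | rewrite eqxx].
Qed.

(** Adjacent sub-squares traverse their common edge in opposite directions, so
    the inner contributions cancel exactly, with no limit involved. *)
Lemma frame_sum_split (R : realType) (f : R[i] -> R[i]) N (z : R[i]) (L : R) :
  let l := L / 2 in
  frame_sum f N.+1 z L =
  frame_sum f N z l + frame_sum f N (z + l%:C) l
  + frame_sum f N (z + 'i * l%:C) l + frame_sum f N (z + l%:C + 'i * l%:C) l.
Proof.
move=> l; rewrite /frame_sum.
have -> : L%:C = l%:C *+ 2.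
  by rewrite -rmorphMn /l -mulr_natr divfK ?pnatr_eq0.
set x : R[i] := l%:C; rewrite /=.
have E1 : x *+ 2 / 2 = x by field.
have E2 : 'i * (x *+ 2) / 2 = 'i * x by rewrite -mulrA E1.
rewrite !mulNr E1 E2.
have r1 a : midpoint_sum f N a (- x) = - midpoint_sum f N (a - x) x.
  by rewrite -midpoint_sum_rev subrK.
have r2 a : midpoint_sum f N a (- ('i * x)) = - midpoint_sum f N (a - 'i * x) ('i * x).
  by rewrite -midpoint_sum_rev subrK.
rewrite !r1 !r2.
have S a b : a = b -> forall v, midpoint_sum f N a v = midpoint_sum f N b v by move=> ->.
(* every base point is brought to the form z + j x + k 'i x; what remains is
   linear in the sums over the 12 half-edges *)
rewrite (S (z + x *+ 2 + 'i * (x *+ 2) - x) (z + x + 'i * x + 'i * x)); last by ring.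
rewrite (S (z + x *+ 2 + 'i * (x *+ 2) - x - x) (z + 'i * x + 'i * x)); last by ring.
rewrite (S (z + 'i * (x *+ 2) - 'i * x) (z + 'i * x)); last by ring.
rewrite (S (z + 'i * (x *+ 2) - 'i * x - 'i * x) z); last by ring.
rewrite (S (z + x *+ 2) (z + x + x)); last by ring.
rewrite (S (z + x *+ 2 + 'i * x) (z + x + 'i * x + x)); last by ring.
rewrite (S (z + x + 'i * x - x) (z + 'i * x)); last by ring.
rewrite (S (z + 'i * x - 'i * x) z); last by ring.
rewrite (S (z + x + x + 'i * x - x) (z + x + 'i * x)); last by ring.
rewrite (S (z + x + 'i * x - 'i * x) (z + x)); last by ring.
rewrite (S (z + 'i * x + x + 'i * x - x) (z + 'i * x + 'i * x)); last by ring.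
rewrite (S (z + 'i * x + 'i * x - 'i * x) (z + 'i * x)); last by ring.
rewrite (S (z + x + 'i * x + x + 'i * x - x) (z + x + 'i * x + 'i * x)); last by ring.
rewrite (S (z + x + 'i * x + 'i * x - 'i * x) (z + x + 'i * x)); last by ring.
rewrite ?(S (z + 'i * x + x) (z + x + 'i * x)); ring.
Qed.

(** * Goursat's theorem *)

(** The mass to which the error is charged in Goursat's argument: the area,
    plus for each exceptional point the width of every square whose vertical
    extent contains that point. Counting the half-open extents [a, b[ and ]a,
    b] makes the second part additive under subdivision, while a closed square
    around an exceptional point still receives at least its side length. *)
Definition frame_weight (R : realType) (E : seq R[i]) (z : R[i]) (L : R) : R :=
  L ^+ 2 + \sum_(p <- E)
    ((if complex.Im z <= complex.Im p < complex.Im z + L then L else 0)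
     + (if complex.Im z < complex.Im p <= complex.Im z + L then L else 0)).

Lemma frame_weight_split (R : realType) (E : seq R[i]) (z : R[i]) (L : R) :
  0 < L -> let l := L / 2 in
  frame_weight E z L =
  frame_weight E z l + frame_weight E (z + l%:C) l
  + frame_weight E (z + 'i * l%:C) l + frame_weight E (z + l%:C + 'i * l%:C) l.
Proof.
move=> L0 l; rewrite /frame_weight.
have -> : L = l + l by rewrite /l; field.
have l0 : 0 < l by rewrite divr_gt0.
rewrite [RHS](_ : _ = (l + l) ^+ 2 + \sum_(p <- E)
  (((if complex.Im z <= complex.Im p < complex.Im z + l then l else 0)
     + (if complex.Im z < complex.Im p <= complex.Im z + l then l else 0)) +
   ((if complex.Im z <= complex.Im p < complex.Im z + l then l else 0)
     + (if complex.Im z < complex.Im p <= complex.Im z + l then l else 0)) +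
   ((if complex.Im z + l <= complex.Im p < complex.Im z + l + l then l else 0)
     + (if complex.Im z + l < complex.Im p <= complex.Im z + l + l then l else 0)) +
   ((if complex.Im z + l <= complex.Im p < complex.Im z + l + l then l else 0)
     + (if complex.Im z + l < complex.Im p <= complex.Im z + l + l then l else 0))));
  last first.
  rewrite !big_split /=.
  have e1 : complex.Im (z + l%:C) = complex.Im z by case: (z) => a b /=; ring.
  have e2 : complex.Im (z + 'i * l%:C) = complex.Im z + l.
    by case: (z) => a b /=; ring.
  have e3 : complex.Im (z + l%:C + 'i * l%:C) = complex.Im z + l.
    by case: (z) => a b /=; ring.
  rewrite e1 e2 e3; ring.
congr (_ + _); apply: eq_bigr => p _; rewrite addrA.
move: (complex.Im z) (complex.Im p) => a x.
case: (leP a x) => h1; case: (ltP x (a + l)) => h2;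
case: (ltP x (a + l + l)) => h3; case: (ltP a x) => h4;
case: (leP x (a + l)) => h5; case: (leP x (a + l + l)) => h6;
  rewrite /=; try (by lra); rewrite ?(ltNge (a + l)) ?h5 /= ?(leNgt (a+l)); lra.
Qed.

Lemma frame_weight_ge_area (R : realType) (E : seq R[i]) (z : R[i]) (L : R) :
  0 <= L -> L ^+ 2 <= frame_weight E z L.
Proof.
move=> L0; rewrite lerDl; apply: sumr_ge0 => p _.
by rewrite addr_ge0 //; case: ifP.
Qed.

Lemma frame_weight_ge_side (R : realType) (E : seq R[i]) (z p : R[i]) (L : R) :
  0 < L -> p \in E -> in_square z L p -> L <= frame_weight E z L.
Proof.
move=> L0 pE [_ /andP[p1 p2]]; rewrite /frame_weight (big_rem p) //=.
rewrite addrCA -[X in X <= _]addr0; apply: lerD; last first.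
  rewrite addr_ge0 ?sqr_ge0 //; apply: sumr_ge0 => q _.
  by rewrite addr_ge0 //; case: ifP => // _; exact: ltW.
rewrite p1 p2 /= andbT; have L0' := ltW L0.
have [h|h] := ltP; first by rewrite lerDl; case: ifP.
by rewrite add0r (lt_le_trans _ h) // ltrDl.
Qed.

(** If P failed on the large square it would fail on a nested sequence of
    dyadic sub-squares, contradicting the local hypothesis at their common
    point. *)
Lemma square_bisection (R : realType) (P : R[i] -> R -> Prop) (z0 : R[i]) (L0 : R) :
  0 < L0 ->
  (forall z L, 0 < L -> let l := L / 2 in
    P z l -> P (z + l%:C) l -> P (z + 'i * l%:C) l ->
    P (z + l%:C + 'i * l%:C) l -> P z L) ->
  (forall p, in_square z0 L0 p -> exists2 d : R, 0 < d &
    forall z L, 0 < L < d -> in_square z L p -> P z L) ->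
  P z0 L0.
Proof.
move=> L00 Psplit Ploc; apply: contrapT => NP0.
have step (z : R[i]) (L : R) : 0 < L -> ~ P z L -> exists z' : R[i],
    [/\ ~ P z' (L / 2),
      complex.Re z <= complex.Re z' <= complex.Re z + L / 2 &
      complex.Im z <= complex.Im z' <= complex.Im z + L / 2].
  move=> Lp NP; apply: contrapT => none; apply: NP; apply: Psplit => //;
    apply: contrapT => NP'; apply: none; eexists; (split; first exact: NP');
    case: (z) => a b /=; lra.
have stepE (zL : R[i] * R) : exists z' : R[i], 0 < zL.2 -> ~ P zL.1 zL.2 ->
    [/\ ~ P z' (zL.2 / 2),
      complex.Re zL.1 <= complex.Re z' <= complex.Re zL.1 + zL.2 / 2 &
      complex.Im zL.1 <= complex.Im z' <= complex.Im zL.1 + zL.2 / 2].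
  have [Lp|?] := pselect (0 < zL.2); last by exists 0.
  have [NP|?] := pselect (~ P zL.1 zL.2); last by exists 0.
  by have [z' ?] := step _ _ Lp NP; exists z'.
have [nxt nxtP] := choice stepE.
pose L n : R := L0 / 2 ^+ n.
have L_gt0 n : 0 < L n by rewrite divr_gt0 // exprn_gt0.
have LS n : L n.+1 = L n / 2.
  by rewrite /L exprSr invfM mulrA.
pose z := fix z n : R[i] := if n is n'.+1 then nxt (z n', L n') else z0.
have NP n : ~ P (z n) (L n).
  elim: n => [|n IH]; first by rewrite /L expr0 divr1.
  by rewrite LS /=; have [] := nxtP (z n, L n) (L_gt0 n) IH.
have zS n : complex.Re (z n) <= complex.Re (z n.+1) <= complex.Re (z n) + L n.+1 /\
    complex.Im (z n) <= complex.Im (z n.+1) <= complex.Im (z n) + L n.+1.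
  by rewrite LS; have [] := nxtP (z n, L n) (L_gt0 n) (NP n).
(* a nondecreasing sequence whose upper ends decrease has a common point *)
have common (u : nat -> R) : (forall n, u n <= u n.+1 <= u n + L n.+1) ->
    exists x, forall n, u n <= x <= u n + L n.
  move=> uS.
  have mono n k : u n <= u (n + k)%N.
    elim: k => [|k IH]; first by rewrite addn0.
    by rewrite addnS; case/andP: (uS (n + k)%N) => h _; exact: le_trans h.
  have anti n k : u (n + k)%N + L (n + k)%N <= u n + L n.
    elim: k => [|k IH]; first by rewrite addn0.
    rewrite addnS (le_trans _ IH) //; case/andP: (uS (n + k)%N) => _.
    by rewrite LS; lra.
  have ub n m : u m <= u n + L n.
    have [/subnKC <-|/ltnW/subnKC <-] := leqP n m.
      by apply: (le_trans _ (anti n (m - n)%N)); rewrite lerDl ltW.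
    by apply: (le_trans (mono m (n - m)%N)); rewrite lerDl ltW.
  exists (sup (range u)) => n; apply/andP; split.
    apply: ub_le_sup; last by exists n.
    by exists (u 0%N + L 0%N) => _ [m _ <-].
  by apply: ge_sup; [exists (u 0%N); exists 0%N | move=> _ [m _ <-]].
have [x xP] := common _ (fun n => (zS n).1).
have [y yP] := common _ (fun n => (zS n).2).
have pQ n : in_square (z n) (L n) (x +i* y) by split.
have [d d0 locP] : exists2 d : R, 0 < d &
    forall z L, 0 < L < d -> in_square z L (x +i* y) -> P z L.
  by apply: Ploc; have := pQ 0%N; rewrite /L expr0 divr1.
pose k := Num.bound (L0 / d).
have Lk : L k < d.
  rewrite /L ltr_pdivrMr ?exprn_gt0 // mulrC -ltr_pdivrMr //.
  have : 0 <= L0 / d by rewrite divr_ge0 // ltW.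
  move=> /archi_boundP /lt_le_trans; apply.
  by rewrite -natrX ler_nat ltnW // ltn_expl.
by apply: (NP k); apply: locP (pQ k); rewrite L_gt0.
Qed.

Lemma frame_sum_norm (R : realType) (f : R[i] -> R[i]) N (z : R[i]) (L M : R) :
  0 <= L -> (forall w, on_frame z L w -> normc (f w) <= M) ->
  normc (frame_sum f N z L) <= 4 * L * M.
Proof.
move=> L0 fM.
have nL : normc (L%:C) = L by rewrite normc_real ger0_norm.
have niL : normc ('i * L%:C) = L by rewrite normcM normci mul1r.
have H (a v : R[i]) : normc v = L ->
   (forall t : R, 0 <= t <= 1 -> on_frame z L (a + t%:C * v)) ->
   normc (midpoint_sum f N a v) <= L * M.
  move=> nv Hv; rewrite -[X in _ <= X * _]nv.
  by apply: midpoint_sum_norm => t /Hv; exact: fM.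
rewrite /frame_sum.
have B1 : normc (midpoint_sum f N z L%:C) <= L * M.
  by apply: H => // t /(frame_edges z L0) [].
have B2 : normc (midpoint_sum f N (z + L%:C) ('i * L%:C)) <= L * M.
  by apply: H => // t /(frame_edges z L0) [].
have B3 : normc (midpoint_sum f N (z + L%:C + 'i * L%:C) (- L%:C)) <= L * M.
  by apply: H; rewrite ?normcN // => t /(frame_edges z L0) [].
have B4 : normc (midpoint_sum f N (z + 'i * L%:C) (- ('i * L%:C))) <= L * M.
  by apply: H; rewrite ?normcN // => t /(frame_edges z L0) [].
apply: (le_trans (normcD _ _)).
apply: (le_trans (lerD (le_trans (normcD _ _) (lerD (le_trans (normcD _ _)
  (lerD B1 B2)) B3)) B4)); lra.
Qed.

(** Midpoint sums are exact on affine functions, and the contour is closed. *)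
Lemma frame_sum_affine (R : realType) (f : R[i] -> R[i]) (a b : R[i]) N (z : R[i])
    (L : R) :
  frame_sum (fun w => f w - (a + b * w)) N z L = frame_sum f N z L.
Proof. by rewrite /frame_sum !midpoint_sumB !midpoint_sum_affine; field. Qed.

Lemma in_square_dist (R : realType) (z p w : R[i]) (L : R) :
  in_square z L p -> in_square z L w -> normc (w - p) <= 2 * L.
Proof.
move=> pQ wQ; apply: (le_trans (normc_Re_Im _)); move: pQ wQ.
case: z p w => a b [c d] [x y] [/= /andP[? ?] /andP[? ?]] [/= /andP[? ?] /andP[? ?]].
rewrite mulr_natl mulr2n.
by apply: lerD; rewrite ler_norml; lra.
Qed.

(** Near a point of derivability f differs from an affine function by o(L) on
    a square of side L, so the sum over its boundary is o(L^2), a small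
    multiple of the area. Near an exceptional point continuity only gives
    o(L), which is charged to the second part of the weight. The index N0
    depends on the dyadic subdivision that is needed. *)
Lemma goursat (R : realType) (E : seq R[i]) (f : R[i] -> R[i]) (z0 : R[i])
    (L0 e : R) : 0 < L0 -> 0 < e ->
  (forall p : R[i], in_square z0 L0 p ->
     cderivable f p \/ (p \in E /\ ccontinuous f p)) ->
  exists N0, forall N, (N0 <= N)%N -> normc (frame_sum f N z0 L0) <= e.
Proof.
move=> L00 e0 df.
have w0 : 0 < frame_weight E z0 L0.
  by rewrite (lt_le_trans _ (frame_weight_ge_area _ _ _)) ?exprn_gt0 // ltW.
pose e' := e / frame_weight E z0 L0.
have e'0 : 0 < e' by rewrite divr_gt0.
suff [N0 H] : exists N0, forall N, (N0 <= N)%N ->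
    normc (frame_sum f N z0 L0) <= e' * frame_weight E z0 L0.
  by exists N0 => N /H; rewrite /e' divfK // gt_eqF.
apply: (square_bisection (P := fun z L => exists N0, forall N, (N0 <= N)%N ->
    normc (frame_sum f N z L) <= e' * frame_weight E z L)) => //.
  move=> z L L_gt0 l [n1 H1] [n2 H2] [n3 H3] [n4 H4].
  exists (n1 + n2 + n3 + n4).+1 => -[//|N]; rewrite ltnS => Nn.
  have dist a b c d : e' * (a + b + c + d) = e' * a + e' * b + e' * c + e' * d.
    by ring.
  rewrite frame_sum_split frame_weight_split // -/l dist.
  have [h1 h2 h3 h4] : [/\ n1 <= N, n2 <= N, n3 <= N & n4 <= N]%N by split; lia.
  apply: (le_trans (normcD _ _)). apply: lerD; last exact: H4.
  apply: (le_trans (normcD _ _)); apply: lerD; last exact: H3.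
  by apply: (le_trans (normcD _ _)); apply: lerD; [exact: H1|exact: H2].
move=> p /df [dfp|[pE cfp]].
  have [b /(_ (e' / 8))[|d d0 H]] := cderivable_normc dfp; first by rewrite divr_gt0.
  exists (d / 2); first by rewrite divr_gt0.
  move=> z L /andP[L_gt0 Ld] pQ; exists 0%N => N _.
  rewrite -(frame_sum_affine _ (f p - b * p) b).
  apply: (@le_trans _ _ (4 * L * (e' / 8 * (2 * L)))); last first.
    apply: (@le_trans _ _ (e' * L ^+ 2)); first by lra.
    by rewrite ler_wpM2l ?frame_weight_ge_area // ltW.
  apply: frame_sum_norm => [|w [wQ _]]; first exact: ltW.
  have D := in_square_dist pQ wQ.
  rewrite (_ : _ - _ = f w - f p - b * (w - p)); last by ring.
  by rewrite (le_trans (H _ _)) //; [lra | rewrite ler_wpM2l //; lra].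
have [d d0 H] := ccontinuous_normc cfp (divr_gt0 e'0 (ltr0n _ 4)).
exists (d / 2); first by rewrite divr_gt0.
move=> z L /andP[L_gt0 Ld] pQ; exists 0%N => N _.
rewrite -(frame_sum_affine _ (f p) 0).
apply: (@le_trans _ _ (4 * L * (e' / 4))); last first.
  apply: (@le_trans _ _ (e' * L)); first by lra.
  by rewrite ler_wpM2l ?(frame_weight_ge_side L_gt0 pE pQ) // ltW.
apply: frame_sum_norm => [|w [wQ _]]; first exact: ltW.
have D := in_square_dist pQ wQ.
by rewrite mul0r addr0 H //; lra.
Qed.

(** * Cauchy's estimate *)

(** Difference quotient with the value b at p; with b the derivative it is
    continuous at p, and this continuity takes the place of the removal of the
    singularity. *)
Definition slope (R : realType) (f : R[i] -> R[i]) (p b w : R[i]) : R[i] :=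
  if w == p then b else (f w - f p) / (w - p).

Lemma near_slope (R : realType) (f : R[i] -> R[i]) (p b q w : R[i]) : q != p ->
  normc (w - q) < normc (q - p) -> (f w - f p) * (w - p)^-1 = slope f p b w.
Proof.
move=> qp wq; rewrite /slope; case: eqP => // wp.
by move: wq; rewrite wp normcB ltxx.
Qed.

Lemma cderivable_slope (R : realType) (f : R[i] -> R[i]) (p b q : R[i]) :
  q != p -> cderivable f q -> cderivable (slope f p b) q.
Proof.
move=> qp df; have qp0 : q - p != 0 by rewrite subr_eq0.
apply: (@near_eq_cderivable R (fun w => (f w - f p) * (w - p)^-1) _ _
  (normc (q - p))).
- by rewrite normc_gt0.
- by move=> w; exact: near_slope.
apply: (@cderivableM R (fun w => f w - f p) (fun w => (w - p)^-1)).
  by apply: cderivableB df _; exact: cderivable_cst.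
apply: (@cderivableV R (fun w => w - p)); first exact: qp0.
exact: (@cderivableB R id (fun=> p) q (cderivable_id q) (cderivable_cst p q)).
Qed.

Lemma ccontinuous_slope (R : realType) (f : R[i] -> R[i]) (p b q : R[i]) :
  q != p -> ccontinuous f q -> ccontinuous (slope f p b) q.
Proof.
move=> qp cf; have qp0 : q - p != 0 by rewrite subr_eq0.
apply: (@near_eq_ccontinuous R (fun w => (f w - f p) * (w - p)^-1) _ _
  (normc (q - p))).
- by rewrite normc_gt0.
- by move=> w; exact: near_slope.
apply: (@ccontinuousM R (fun w => f w - f p) (fun w => (w - p)^-1)).
  by apply: ccontinuousB cf _; apply: cderivable_continuous; exact: cderivable_cst.
apply: (@cderivable_continuous R (fun w => (w - p)^-1)).
apply: (@cderivableV R (fun w => w - p)); first exact: qp0.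
exact: (@cderivableB R id (fun=> p) q (cderivable_id q) (cderivable_cst p q)).
Qed.

Lemma ccontinuous_slope_at (R : realType) (f : R[i] -> R[i]) (p : R[i]) :
  cderivable f p -> exists b, ccontinuous (slope f p b) p.
Proof.
move=> /cderivable_normc[b H]; exists b; apply: normc_ccontinuous => e e0.
have [d d0 Hd] := H e e0; exists d => // w /Hd; rewrite /slope eqxx.
have [_ _|wp] := eqVneq w p; first by rewrite subrr normc0 ltW.
rewrite -subr_eq0 in wp.
have -> : (f w - f p) / (w - p) - b = (f w - f p - b * (w - p)) / (w - p).
  by rewrite [RHS]mulrBl mulfK.
by rewrite normcM normcV ler_pdivrMr ?normc_gt0.
Qed.

Lemma eq_frame_sum (R : realType) (f g : R[i] -> R[i]) N (z : R[i]) (L : R) :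
  0 <= L -> (forall w, on_frame z L w -> f w = g w) ->
  frame_sum f N z L = frame_sum g N z L.
Proof.
move=> L0 fg; rewrite /frame_sum.
by congr (_ + _ + _ + _); apply: eq_midpoint_sum => t t01;
  apply: fg; have [] := frame_edges z L0 t01.
Qed.

Lemma frame_sumB (R : realType) (f g : R[i] -> R[i]) N (z : R[i]) (L : R) :
  frame_sum (fun w => f w - g w) N z L = frame_sum f N z L - frame_sum g N z L.
Proof. by rewrite /frame_sum !midpoint_sumB; ring. Qed.

Lemma frame_sumZ (R : realType) (c : R[i]) (f : R[i] -> R[i]) N (z : R[i]) (L : R) :
  frame_sum (fun w => c * f w) N z L = c * frame_sum f N z L.
Proof. by rewrite /frame_sum !midpoint_sumZ; ring. Qed.

Definition centred_corner (R : realType) (r : R) : R[i] := (- r) +i* (- r).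

Lemma frame_dist (R : realType) (r : R) (z0 w : R[i]) :
  `|complex.Re z0| <= r / 2 -> `|complex.Im z0| <= r / 2 ->
  on_frame (centred_corner r) (2 * r) w -> r / 2 <= normc (w - z0).
Proof.
case: z0 => a b /= a1 b1 [_]; move: a1 b1; rewrite !ler_norml.
move=> /andP[a1 a2] /andP[b1 b2].
have HR := normc_Re (w - (a +i* b)); have HI := normc_Im (w - (a +i* b)).
case: w HR HI => x y HR HI /or4P[] /eqP /= E.
- by apply: le_trans HR => /=; rewrite ler_normr E; apply/orP; right; lra.
- by apply: le_trans HR => /=; rewrite ler_normr E; apply/orP; left; lra.
- by apply: le_trans HI => /=; rewrite ler_normr E; apply/orP; right; lra.
- by apply: le_trans HI => /=; rewrite ler_normr E; apply/orP; left; lra.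
Qed.

(** The imaginary part of each of the four sums is a sum of positive terms 2 r
    d / (d^2 + x^2), where d is the distance from z0 to the edge; each sum is
    at least 2/9. *)
Lemma frame_sum_cauchy_kernel (R : realType) (r : R) (z0 : R[i]) N :
  0 < r -> `|complex.Re z0| <= r / 2 -> `|complex.Im z0| <= r / 2 ->
  8 / 9 <= normc (frame_sum (fun w => (w - z0)^-1) N (centred_corner r) (2 * r)).
Proof.
case: z0 => a b r0 /=; rewrite !ler_norml => /andP[a1 a2] /andP[b1 b2].
have ker (d x : R) : r / 2 <= d <= 3 / 2 * r -> - (3 / 2 * r) <= x <= 3 / 2 * r ->
    2 / 9 <= 2 * r * d / (d ^+ 2 + x ^+ 2).
  move=> /andP[d1 d2] /andP[x1 x2].
  have d0 : 0 < d by lra.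
  have : 0 < d ^+ 2 + x ^+ 2 by rewrite ltr_pwDl ?sqr_ge0 ?exprn_gt0.
  move=> h; rewrite ler_pdivlMr //.
  have : (d - 3 / 2 * r) * (d + 3 / 2 * r) <= 0 by rewrite mulr_le0_ge0 //; lra.
  have : (x - 3 / 2 * r) * (x + 3 / 2 * r) <= 0 by rewrite mulr_le0_ge0 //; lra.
  have : 0 <= r * (d - r / 2) by rewrite mulr_ge0 //; lra.
  lra.
apply: le_trans (le_trans (ler_norm _) (normc_Im _)).
rewrite /frame_sum.
have E1 : 2 / 9 <= complex.Im (midpoint_sum (fun w => (w - (a +i* b))^-1) N
    (centred_corner r) (2 * r)%:C).
  apply: midpoint_sum_Im => t /andP[t0 t1].
  have h : 0 <= t * (2 * r) <= 2 * r by rewrite mulr_ge0 ?ler_piMl //; lra.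
  have := ker (r + b) (- r + t * (2 * r) - a); move/(_ ltac:(lra) ltac:(lra)).
  move/le_trans; apply; rewrite le_eqVlt; apply/orP; left; apply/eqP => /=.
  rewrite !(mul0r, mulr0, mul1r, addr0, add0r, subr0, sub0r, oppr0, mulrN, opprK).
  have -> : (- r + t * (2 * r) - a) ^+ 2 + (- r - b) ^+ 2 =
            (r + b) ^+ 2 + (- r + t * (2 * r) - a) ^+ 2 by ring.
  by ring.
have E2 : 2 / 9 <= complex.Im (midpoint_sum (fun w => (w - (a +i* b))^-1) N
    (centred_corner r + (2 * r)%:C) ('i * (2 * r)%:C)).
  apply: midpoint_sum_Im => t /andP[t0 t1].
  have h : 0 <= t * (2 * r) <= 2 * r by rewrite mulr_ge0 ?ler_piMl //; lra.
  have := ker (r - a) (- r + t * (2 * r) - b); move/(_ ltac:(lra) ltac:(lra)).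
  move/le_trans; apply; rewrite le_eqVlt; apply/orP; left; apply/eqP => /=.
  rewrite !(mul0r, mulr0, mul1r, addr0, add0r, subr0, sub0r, oppr0, mulrN, opprK).
  have -> : - r + 2 * r - a = r - a by ring.
  by ring.
have E3 : 2 / 9 <= complex.Im (midpoint_sum (fun w => (w - (a +i* b))^-1) N
    (centred_corner r + (2 * r)%:C + 'i * (2 * r)%:C) (- (2 * r)%:C)).
  apply: midpoint_sum_Im => t /andP[t0 t1].
  have h : 0 <= t * (2 * r) <= 2 * r by rewrite mulr_ge0 ?ler_piMl //; lra.
  have := ker (r - b) (r - t * (2 * r) - a); move/(_ ltac:(lra) ltac:(lra)).
  move/le_trans; apply; rewrite le_eqVlt; apply/orP; left; apply/eqP => /=.
  rewrite !(mul0r, mulr0, mul1r, addr0, add0r, subr0, sub0r, oppr0, mulrN, opprK).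
  have -> : (- r + 2 * r - t * (2 * r) - a) ^+ 2 + (- r + 2 * r - b) ^+ 2 =
            (r - b) ^+ 2 + (r - t * (2 * r) - a) ^+ 2 by ring.
  by ring.
have E4 : 2 / 9 <= complex.Im (midpoint_sum (fun w => (w - (a +i* b))^-1) N
    (centred_corner r + 'i * (2 * r)%:C) (- ('i * (2 * r)%:C))).
  apply: midpoint_sum_Im => t /andP[t0 t1].
  have h : 0 <= t * (2 * r) <= 2 * r by rewrite mulr_ge0 ?ler_piMl //; lra.
  have := ker (r + a) (r - t * (2 * r) - b); move/(_ ltac:(lra) ltac:(lra)).
  move/le_trans; apply; rewrite le_eqVlt; apply/orP; left; apply/eqP => /=.
  rewrite !(mul0r, mulr0, mul1r, addr0, add0r, subr0, sub0r, oppr0, mulrN, opprK).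
  have -> : (- r - a) ^+ 2 + (- r + 2 * r - t * (2 * r) - b) ^+ 2 =
            (r + a) ^+ 2 + (r - t * (2 * r) - b) ^+ 2 by ring.
  by ring.
move: E1 E2 E3 E4; do 4 case: (midpoint_sum _ _ _ _) => ? ? /=.
lra.
Qed.

(** Goursat's theorem for the difference quotient of f at z0 shows that f z0
    times the sum of the Cauchy kernel is, up to e, the sum of f w / (w - z0).
    The latter is at most 4 (2 r) B / (r / 2) = 16 B and the former has
    modulus at least 8/9 |f z0|. Exceptional points are allowed because the
    estimate is applied to difference quotients. *)
Lemma cauchy_bound (R : realType) (E : seq R[i]) (f : R[i] -> R[i]) (r B : R)
    (z0 : R[i]) : 0 < r ->
  `|complex.Re z0| <= r / 2 -> `|complex.Im z0| <= r / 2 ->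
  (forall p, in_square (centred_corner r) (2 * r) p ->
     cderivable f p \/ (p \in E /\ ccontinuous f p)) ->
  cderivable f z0 ->
  (forall w, on_frame (centred_corner r) (2 * r) w -> normc (f w) <= B) ->
  normc (f z0) <= 18 * B.
Proof.
move=> r0 az bz df dfz fB.
have r20 : 0 < 2 * r by rewrite mulr_gt0.
have [b cb] := ccontinuous_slope_at dfz.
pose K w := (w - z0)^-1.
have fz_ge0 := normc_ge0 (f z0).
suff main e : 0 < e -> normc (f z0) * (8 / 9) <= 16 * B + e.
  suff : normc (f z0) * (8 / 9) <= 16 * B by lra.
  by apply/ler_addgt0Pr => e /main.
move=> e0.
have [|N0 HN] := @goursat R (z0 :: E) (slope f z0 b) (centred_corner r) (2 * r) e r20 e0.
  move=> p pQ; have [->|pz] := eqVneq p z0.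
    by right; rewrite mem_head.
  have [dp|[pE cp]] := df p pQ; first by left; exact (cderivable_slope (b := b) pz dp).
  by right; split; [rewrite in_cons pE orbT | exact (ccontinuous_slope (b := b) pz cp)].
have {HN} := HN N0 (leqnn _).
have frameN w : on_frame (centred_corner r) (2 * r) w -> r / 2 <= normc (w - z0).
  exact: frame_dist.
have -> : frame_sum (slope f z0 b) N0 (centred_corner r) (2 * r) =
    frame_sum (fun w => f w * K w) N0 (centred_corner r) (2 * r)
    - f z0 * frame_sum K N0 (centred_corner r) (2 * r).
  rewrite -frame_sumZ -frame_sumB; apply: eq_frame_sum; first exact: ltW.
  move=> w /frameN wz; rewrite /slope; case: eqP => [wE|_]; last by rewrite mulrBl.
  by move: wz; rewrite wE subrr normc0 leNgt divr_gt0.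
set I := frame_sum _ _ _ _; set J := frame_sum _ _ _ _ => HE.
have IB : normc I <= 16 * B.
  apply: (@le_trans _ _ (4 * (2 * r) * (B / (r / 2)))).
    apply: frame_sum_norm; first exact: ltW.
    move=> w wF; rewrite normcM normcV.
    have := frameN _ wF; have := fB _ wF; have r2 : 0 < r / 2 by rewrite divr_gt0.
    move=> h1 h2; apply: ler_pM; rewrite ?normc_ge0 ?invr_ge0 ?normc_ge0 //.
    by rewrite lef_pV2 ?posrE // (lt_le_trans r2).
  by rewrite le_eqVlt; apply/orP; left; apply/eqP; field; rewrite gt_eqF.
have JB : 8 / 9 <= normc J by apply: frame_sum_cauchy_kernel.
have : normc (f z0 * J) <= normc I + normc (I - f z0 * J).
  rewrite -[X in normc X <= _](subKr I) (le_trans (normcD _ _)) //.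
  by rewrite normcN.
rewrite normcM => H; have : normc (f z0) * (8 / 9) <= normc (f z0) * normc J.
  by rewrite ler_wpM2l.
lra.
Qed.

(** * Schwarz lemmas and maps omitting a ray *)

Lemma centred_square_sub_disc (R : realType) (p : R[i]) :
  in_square (centred_corner (2^-1)) (2 * 2^-1) p -> normc p < 1.
Proof.
case: p => a b [] /= /andP[a1 a2] /andP[b1 b2].
have ha : (a - 1 / 2) * (a + 1 / 2) <= 0 by rewrite mulr_le0_ge0 //; lra.
have hb : (b - 1 / 2) * (b + 1 / 2) <= 0 by rewrite mulr_le0_ge0 //; lra.
by rewrite -sqrtr1 ltr_sqrt //; lra.
Qed.

(** Cauchy's estimate for the difference quotient of f at 0, which is at most
    2 / (1/4) = 8 on the boundary of the square of half-side 1/2; 144 = 18 *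
    8. *)
Lemma schwarz (R : realType) (f : R[i] -> R[i]) (z : R[i]) :
  (forall w, normc w < 1 -> cderivable f w) ->
  (forall w, normc w < 1 -> normc (f w) <= 1) ->
  normc z < 1 -> normc (f z - f 0) <= 144 * normc z.
Proof.
move=> df fB z1; have z_ge0 := normc_ge0 z.
have D1 : normc (0 : R[i]) < 1 by rewrite normc0.
have B2 w : normc w < 1 -> normc (f w - f 0) <= 2.
  move=> w1; rewrite (le_trans (normcD _ _)) // normcN.
  by have := fB _ w1; have := fB _ D1; lra.
have [zbig|zsmall] := ltP (4^-1 : R) (normc z).
  by have := B2 _ z1; lra.
have [->|z0] := eqVneq z 0; first by rewrite subrr normc0 mulr0.
have [b cb] := ccontinuous_slope_at (df _ D1).
have h : normc (slope f 0 b z) <= 18 * 8.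
  have z1R := le_trans (normc_Re z) zsmall; have z1I := le_trans (normc_Im z) zsmall.
  apply: (@cauchy_bound R [:: 0] (slope f 0 b) 2^-1 8 z); [lra|lra|lra| | |].
  - move=> p /centred_square_sub_disc p1; have [->|p0] := eqVneq p 0.
      by right; split; [rewrite mem_head|exact cb].
    by left; exact (cderivable_slope (b := b) p0 (df p p1)).
  - exact (cderivable_slope (b := b) z0 (df z z1)).
  move=> w wF; have w4 : 2^-1 / 2 <= normc (w - 0).
    by apply: frame_dist wF => /=; rewrite normr0; lra.
  have w1 := centred_square_sub_disc wF.1; have w00 : w != 0.
    by apply/eqP => w0; move: w4; rewrite w0 subrr normc0; lra.
  rewrite /slope (negPf w00) subr0 normcM normcV ler_pdivrMr ?normc_gt0 //.
  by have := B2 _ w1; move: w4; rewrite subr0; lra.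
move: h; rewrite /slope (negPf z0) subr0 normcM normcV ler_pdivrMr ?normc_gt0 //.
lra.
Qed.

(** The same with f divided by both factors: the quotient is at most 16 on the
    boundary, and 288 = 18 * 16. *)
Lemma schwarz_two_zeros (R : realType) (f : R[i] -> R[i]) (a z : R[i]) :
  (forall w, normc w < 1 -> cderivable f w) ->
  (forall w, normc w < 1 -> normc (f w) <= 1) ->
  f 0 = 0 -> f a = 0 -> a != 0 -> normc a <= 4^-1 -> normc z <= 4^-1 ->
  normc (f z) <= 288 * (normc z * normc (z - a)).
Proof.
move=> df fB f0 fa a0 a4 z4.
have D1 : normc (0 : R[i]) < 1 by rewrite normc0.
have a1 : normc a < 1 by lra.
have z1 : normc z < 1 by lra.
have [z0|z0] := eqVneq z 0; first by rewrite z0 f0 normc0 mul0r mulr0.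
have [za|za] := eqVneq z a; first by rewrite za fa subrr normc0 !mulr0.
have za0 : z - a != 0 by rewrite subr_eq0.
have [b cb] := ccontinuous_slope_at (df _ D1).
pose g := slope f 0 b.
have dg w : normc w < 1 -> w != 0 -> cderivable g w.
  by move=> w1 w0; exact (cderivable_slope (b := b) w0 (df w w1)).
have [c cc] := ccontinuous_slope_at (dg _ a1 a0).
have hE w : w != 0 -> w != a -> slope g a c w = f w / w / (w - a).
  move=> w0 wa; rewrite /slope (negPf wa) /g /slope (negPf w0) (negPf a0).
  by rewrite f0 fa !subr0 mul0r subr0.
have h : normc (slope g a c z) <= 18 * 16.
  have z1R := le_trans (normc_Re z) z4; have z1I := le_trans (normc_Im z) z4.
  have a1R := le_trans (normc_Re a) a4; have a1I := le_trans (normc_Im a) a4.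
  apply: (@cauchy_bound R [:: 0; a] (slope g a c) 2^-1 16 z); [lra|lra|lra| | |].
  - move=> p /centred_square_sub_disc p1; have [->|p0] := eqVneq p 0.
      right; split; first by rewrite mem_head.
      by apply: (@ccontinuous_slope R g a c 0 _ cb); rewrite eq_sym.
    have [->|pa] := eqVneq p a.
      by right; split; [rewrite in_cons mem_head orbT|exact cc].
    by left; exact (cderivable_slope (b := c) pa (dg p p1 p0)).
  - exact (cderivable_slope (b := c) za (dg z z1 z0)).
  move=> w wF; have w1 := centred_square_sub_disc wF.1.
  have w4 : 2^-1 / 2 <= normc (w - 0).
    by apply: frame_dist wF => /=; rewrite normr0; lra.
  have wa4 : 2^-1 / 2 <= normc (w - a) by apply: frame_dist wF => /=; lra.
  rewrite subr0 in w4.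
  have w00 : w != 0 by rewrite -normc_gt0; lra.
  have wa0 : w - a != 0 by rewrite -normc_gt0; lra.
  have wa : w != a by rewrite -subr_eq0.
  rewrite (hE _ w00 wa) !normcM !normcV.
  rewrite ler_pdivrMr ?normc_gt0; last exact: wa0.
  rewrite ler_pdivrMr ?normc_gt0; last exact: w00.
  have := fB _ w1; have : 4^-1 * 4^-1 <= normc (w - a) * normc w by apply: ler_pM; lra.
  lra.
move: h; rewrite (hE _ z0 za) !normcM !normcV.
rewrite ler_pdivrMr ?normc_gt0; last exact: za0.
rewrite ler_pdivrMr ?normc_gt0; last exact: z0.
lra.
Qed.

Lemma normc_cderivable (R : realType) (f : R[i] -> R[i]) (p b : R[i]) :
  (forall e : R, 0 < e -> exists2 d : R, 0 < d & forall w, normc (w - p) < d ->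
     normc (f w - f p - b * (w - p)) <= e * normc (w - p)) ->
  cderivable f p.
Proof.
have aux (g : R[i]^o -> R[i]^o) (q : R[i]^o) (c : R[i]^o) :
  (forall e : R, 0 < e -> exists2 d : R, 0 < d & forall w, normc (w - q) < d ->
     normc (g w - g q - c * (w - q)) <= e * normc (w - q)) -> derivable g q 1.
  move=> H; apply/cvg_ex; exists c; apply/cvgrPdist_le => e e0.
  have eE : e = (complex.Re e)%:C by rewrite RRe_real // gtr0_real.
  rewrite eE; rewrite eE ltcR in e0; have [d d0 Hd] := H _ e0.
  rewrite near_withinE; apply/nbhs_normc; exists d => // h; rewrite subr0 => hd h0.
  rewrite normcE lecR /GRing.scale /= mulr1.
  have := Hd (h + q); rewrite addrK => /(_ hd) {}Hd.
  rewrite normcB (_ : _ - c = h^-1 * (g (h + q) - g q - c * h)); last first.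
    by rewrite [RHS]mulrBr [h^-1 * (c * h)]mulrCA mulVf // mulr1.
  by rewrite normcM normcV mulrC ler_pdivrMr ?normc_gt0.
by move=> H; apply/cderivableP; exact: aux H.
Qed.

(** Reduces derivability of the square root below to continuity of a factor.
    *)
Lemma caratheodory_cderivable (R : realType) (f q : R[i] -> R[i]) (p : R[i]) :
  ccontinuous q p -> (forall w, f w - f p = q w * (w - p)) -> cderivable f p.
Proof.
move=> cq fq; apply: (@normc_cderivable _ _ _ (q p)) => e /(ccontinuous_normc cq).
move=> [d d0 H]; exists d => // w /H qe.
by rewrite fq -mulrBl normcM ler_wpM2r ?normc_ge0.
Qed.

Lemma cderivable_scale (R : realType) (f : R[i] -> R[i]) (r : R) (p : R[i]) :
  0 < r -> cderivable f (r%:C * p) -> cderivable (fun w => f (r%:C * w)) p.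
Proof.
move=> r0 /cderivable_normc[b H]; apply: (@normc_cderivable _ _ _ (b * r%:C)) => e e0.
have [d d0 Hd] := H _ (divr_gt0 e0 r0).
have sc w : normc (r%:C * w - r%:C * p) = r * normc (w - p).
  by rewrite -mulrBr normcM normc_real gtr0_norm.
exists (d / r); first by rewrite divr_gt0.
move=> w; rewrite ltr_pdivlMr // mulrC -sc => /Hd; rewrite sc.
by rewrite -mulrBr mulrA mulrA divfK // gt_eqF.
Qed.

Lemma Re_sqrtc_ge0 (R : realType) (x : R[i]) : 0 <= complex.Re (sqrtc x).
Proof. by case: x => a b; exact: sqrtr_ge0. Qed.

Lemma Re_sqrtc_gt0 (R : realType) (x : R[i]) :
  (forall t : R, t <= 0 -> x <> t%:C) -> 0 < complex.Re (sqrtc x).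
Proof.
move=> xN; rewrite lt_neqAle Re_sqrtc_ge0 andbT; apply/eqP => s0.
move: (sqr_sqrtc x); move: s0; case: (sqrtc x) => a b /= <- E.
apply: (xN (- b ^+ 2)); first by rewrite oppr_le0 sqr_ge0.
by rewrite -E expr2; simpc; rewrite expr2.
Qed.

(** Since (g w - g p) (g w + g p) = f w - f p for g the square root of f, the
    bound |g w + g p| >= Re (g p) > 0 gives first continuity, then
    derivability. *)
Lemma cderivable_sqrt (R : realType) (f : R[i] -> R[i]) (p : R[i]) :
  cderivable f p -> 0 < complex.Re (sqrtc (f p)) ->
  cderivable (fun w => sqrtc (f w)) p.
Proof.
move=> df gp; pose g w := sqrtc (f w).
have gpE : complex.Re (g p) = complex.Re (sqrtc (f p)) by [].
have ggp w : complex.Re (g p) <= normc (g w + g p).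
  apply: le_trans (le_trans (ler_norm _) (normc_Re _)).
  have := Re_sqrtc_ge0 (f w); rewrite -/(g w).
  by case: (g w) => a b; case: (g p) => a' b' /=; lra.
have gN w : g w + g p != 0 by rewrite -normc_gt0 (lt_le_trans gp).
have gB w : g w - g p = (f w - f p) / (g w + g p).
  apply: (mulIf (gN w)); rewrite divfK // -subr_sqr.
  by rewrite /g !sqr_sqrtc.
have [b cb] := ccontinuous_slope_at df.
have cg : ccontinuous g p.
  apply: normc_ccontinuous => e e0.
  have [d d0 H] := ccontinuous_normc (cderivable_continuous df) (mulr_gt0 e0 gp).
  exists d => // w /H fe; rewrite gB normcM normcV ler_pdivrMr ?normc_gt0 //.
  by rewrite (le_trans fe) // ler_wpM2l ?ggp // ltW.
apply: (@caratheodory_cderivable R g (fun w => slope f p b w * (g w + g p)^-1)).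
  apply: (@ccontinuousM R _ (fun w => (g w + g p)^-1)); first exact cb.
  apply: (@ccontinuousV R (fun w => g w + g p)); first exact: gN.
  apply: (@ccontinuousD R g (fun=> g p)); first exact cg.
  exact (cderivable_continuous (cderivable_cst _ _)).
move=> w; rewrite gB /slope; case: eqP => [->|/eqP wp].
  by rewrite !subrr mul0r mulr0.
by rewrite mulrAC divfK // subr_eq0.
Qed.

Lemma normc_half_plane (R : realType) (a b : R[i]) :
  0 <= complex.Re a -> 0 <= complex.Re b -> normc (a - b) <= normc (a + b^*).
Proof.
case: a b => x y [u v] /= x0 u0; apply: ler_wsqrtr.
have := mulr_ge0 x0 u0; lra.
Qed.

(** The square root g of A - f has positive real part, so k = (g - g 0) / (g +
    conj (g 0)) maps the disc of radius r to the unit disc and vanishes at 0.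
    The Schwarz lemma gives |k| <= 144 |z| / r, at most 1/2 in the stated
    range; solving for g yields |g - g 0| <= 4 |k| |g 0|, and f - f 0 is the
    difference of the squares. Here 288 = 2 * 144 and 2304 = 16 * 144. *)
Lemma slit_bound (R : realType) (f : R[i] -> R[i]) (r A : R) (z : R[i]) : 0 < r ->
  (forall w, normc w < r -> cderivable f w) ->
  (forall w, normc w < r -> forall x : R, A <= x -> f w <> x%:C) ->
  normc z <= r / 288 ->
  normc (f z - f 0) <= 2304 / r * normc z * normc (A%:C - f 0).
Proof.
move=> r0 df slit zr.
pose g w := sqrtc (A%:C - f w).
have g_gt0 w : normc w < r -> 0 < complex.Re (g w).
  move=> wr; apply: Re_sqrtc_gt0 => t t0 E; apply: (slit w wr (A - t)); first lra.
  have -> : f w = A%:C - t%:C by rewrite -E; ring.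
  by rewrite -rmorphB.
have D1 : normc (0 : R[i]) < r by rewrite normc0.
have g0_gt0 := g_gt0 _ D1.
have dg w : normc w < r -> cderivable g w.
  move=> wr; apply: (@cderivable_sqrt R (fun w => A%:C - f w)); last exact: g_gt0.
  apply: (@cderivableB R (fun=> A%:C)); [exact (cderivable_cst _ _)|exact (df w wr)].
pose k w := (g (r%:C * w) - g 0) * (g (r%:C * w) + (g 0)^*)^-1.
have rw w : normc w < 1 -> normc (r%:C * w) < r.
  by move=> w1; rewrite normcM normc_real gtr0_norm // gtr_pMr.
have den w : normc w < 1 -> g (r%:C * w) + (g 0)^* != 0.
  move=> w1; have := g_gt0 _ (rw _ w1); move: g0_gt0.
  case: (g (r%:C * w)) => a b; case: (g 0) => c d /= c0 a0.
  by rewrite eq_complex /= negb_and gt_eqF // addr_gt0.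
have k00 : k 0 = 0 by rewrite /k mulr0 subrr mul0r.
have dk w : normc w < 1 -> cderivable k w.
  move=> w1; have dgr := cderivable_scale r0 (dg _ (rw _ w1)).
  apply: (@cderivableM R (fun w => g (r%:C * w) - g 0)
    (fun w => (g (r%:C * w) + (g 0)^*)^-1)).
    exact (cderivableB dgr (cderivable_cst _ _)).
  apply: (@cderivableV R (fun w => g (r%:C * w) + (g 0)^*)); first exact: den.
  exact (cderivableD dgr (cderivable_cst _ _)).
have k1 w : normc w < 1 -> normc (k w) <= 1.
  move=> w1; rewrite normcM normcV ler_pdivrMr ?normc_gt0 ?den // mul1r.
  by apply: normc_half_plane; apply: ltW; rewrite ?g_gt0 ?rw.
pose y := z / r%:C.
have rN : r%:C != 0 by rewrite -normc_gt0 normc_real gtr0_norm.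
have yE : normc y = normc z / r by rewrite normcM normcV normc_real gtr0_norm.
have y288 : normc y <= 288^-1 by rewrite yE ler_pdivrMr //; lra.
have y1 : normc y < 1 by lra.
have := schwarz dk k1 y1; rewrite k00 subr0 => ky.
have ryE : r%:C * y = z by rewrite mulrC divfK.
have D := den _ y1; have kE : k y * (g z + (g 0)^*) = g z - g 0.
  by rewrite /k ryE divfK // -ryE.
pose kk := normc (k y); have kk_ge0 : 0 <= kk := normc_ge0 _.
have kk2 : kk <= 1 / 2 by rewrite /kk; lra.
have nconj : normc (g 0)^* = normc (g 0) by case: (g 0) => a b /=; rewrite sqrrN.
have gz : normc (g z - g 0) <= kk * (normc (g z - g 0) + 2 * normc (g 0)).
  rewrite -[X in X <= _]/(normc (g z - g 0)) -{1}kE normcM ler_wpM2l //.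
  have -> : g z + (g 0)^* = (g z - g 0) + (g 0 + (g 0)^*) by ring.
  rewrite (le_trans (normcD _ _)) // lerD2l (le_trans (normcD _ _)) // nconj; lra.
have g00 := normc_ge0 (g 0); have G0 := normc_ge0 (g z - g 0).
have GG : kk * normc (g z - g 0) <= 1 / 2 * normc (g z - g 0) by rewrite ler_wpM2r.
have G4 : normc (g z - g 0) <= 4 * kk * normc (g 0) by lra.
have Gs : normc (g z + g 0) <= 4 * normc (g 0).
  have -> : g z + g 0 = (g z - g 0) + (g 0 + g 0) by ring.
  have := mulr_ge0 kk_ge0 g00.
  have : kk * normc (g 0) <= 1 / 2 * normc (g 0) by rewrite ler_wpM2r.
  have := normcD (g z - g 0) (g 0 + g 0); have := normcD (g 0) (g 0); lra.
have -> : f z - f 0 = - ((g z - g 0) * (g z + g 0)).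
  rewrite -subr_sqr /g !sqr_sqrtc; ring.
have -> : A%:C - f 0 = g 0 * g 0 by rewrite -expr2 sqr_sqrtc.
rewrite normcN !normcM.
apply: (le_trans (ler_pM _ _ G4 Gs)); rewrite ?normc_ge0 //.
have : kk * (normc (g 0) * normc (g 0)) <=
    144 * normc y * (normc (g 0) * normc (g 0)) by rewrite ler_wpM2r ?mulr_ge0.
rewrite yE; lra.
Qed.

(** * Lower bounds *)

Lemma lempert_ge (R : realType) n (M : set 'rV[R[i]]_n.+1) (z w : 'rV[R[i]]_n.+1)
    (c : R) :
  (forall a phi, normc a < 1 -> holomorphic_disc M phi -> phi 0 = z ->
     phi a = w -> c <= normc a) ->
  (c%:E <= lempert M z w)%E.
Proof.
move=> H; apply: le_ereal_inf_tmp => _ [a [a1 [phi [hphi phi0 phia]]] <-].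
by rewrite lee_fin; exact: H hphi phi0 phia.
Qed.

Lemma lempert_ge0 (R : realType) n (M : set 'rV[R[i]]_n.+1) (z w : 'rV[R[i]]_n.+1) :
  (0 <= lempert M z w)%E.
Proof. by apply: lempert_ge => a *; exact: normc_ge0. Qed.

Definition in_polydisc (R : realType) n (M : set 'rV[R[i]]_n.+1) :=
  forall z, M z -> forall j, normc (z 0 j) < 1.

Lemma Gt_dom_in_polydisc (R : realType) n (mu : R) : in_polydisc (Gt_dom n mu).
Proof. by move=> z [zD _] j; exact: zD. Qed.

Lemma holomorphic_disc_cderivable (R : realType) n (M : set 'rV[R[i]]_n.+1) phi j w :
  holomorphic_disc M phi -> normc w < 1 -> cderivable (fun x => phi x 0 j) w.
Proof. by move=> hphi w1; apply/cderivableP; have [_] := hphi w w1; exact. Qed.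

Lemma holomorphic_disc_schwarz (R : realType) n (M : set 'rV[R[i]]_n.+1) phi j z :
  in_polydisc M -> holomorphic_disc M phi -> normc z < 1 ->
  normc (phi z 0 j - phi 0 0 j) <= 144 * normc z.
Proof.
move=> MD hphi z1; apply: (@schwarz R (fun x => phi x 0 j)) => // w w1.
  exact: holomorphic_disc_cderivable hphi w1.
by apply: ltW; apply: MD; have [] := hphi w w1.
Qed.

(** Schwarz lemma for one coordinate; it settles the cases where the exponent
    of eps is zero, and controls the remaining coordinates along a chain. *)
Lemma lempert_ge_dist (R : realType) n (M : set 'rV[R[i]]_n.+1)
    (z w : 'rV[R[i]]_n.+1) j : in_polydisc M ->
  ((normc (w 0 j - z 0 j) / 144)%:E <= lempert M z w)%E.
Proof.
move=> MD; apply: lempert_ge => a phi a1 hphi <- <-.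
by have := holomorphic_disc_schwarz j MD hphi a1; lra.
Qed.

Lemma sum_lempert_ge_dist (R : realType) n (M : set 'rV[R[i]]_n.+1)
    (y : nat -> 'rV[R[i]]_n.+1) k j : in_polydisc M ->
  ((normc (y k 0 j - y 0%N 0 j) / 144)%:E <=
   \sum_(i < k) lempert M (y i) (y i.+1))%E.
Proof.
move=> MD; elim: k => [|k IH]; first by rewrite big_ord0 subrr normc0 mul0r.
rewrite big_ord_recr /=; apply: le_trans (leeD IH (lempert_ge_dist _ _ j MD)).
rewrite -EFinD lee_fin -mulrDl ler_wpM2r //.
have -> : y k.+1 0 j - y 0%N 0 j = (y k 0 j - y 0%N 0 j) + (y k.+1 0 j - y k 0 j).
  by ring.
exact: normcD.
Qed.

Lemma powR_le1 (R : realType) (x p : R) : 0 <= x <= 1 -> 0 <= p -> x `^ p <= 1.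
Proof.
move=> /andP[x0 x1] p0; have : x `^ p <= 1 `^ p by apply: ge0_ler_powR; rewrite ?nnegrE.
by rewrite powR1.
Qed.

Lemma sum_powR_le (R : realType) n (mu rho e : R) (u : 'I_n -> R) :
  0 < mu <= 2 -> 0 <= rho -> rho `^ mu = e ->
  (forall j, 0 <= u j <= 37 * rho) -> \sum_(j < n) u j `^ mu <= 1369 * n%:R * e.
Proof.
move=> /andP[mu0 mu2] rho0 rhoE uB.
have -> : 1369 * n%:R * e = \sum_(j < n) 1369 * e.
  by rewrite big_const_ord iter_addr_0 -mulr_natr; ring.
apply: ler_sum => j _; have /andP[u0 u37] := uB j.
apply: (@le_trans _ _ ((37 * rho) `^ mu)).
  by apply: ge0_ler_powR; rewrite ?nnegrE ?mulr_ge0 // ltW.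
rewrite powRM // rhoE ler_wpM2r //; first by rewrite -rhoE powR_ge0.
apply: (le_trans (ler_powR _ mu2)); first lra.
by rewrite (powR_mulrn 2) // expr2; lra.
Qed.

(** At a real first coordinate the term with the imaginary part vanishes; 1369
    = 37^2 bounds 37^mu for mu <= 2. *)
Lemma Gt_dom_slit (R : realType) n (mu rho e : R) (z : 'rV[R[i]]_n.+1) :
  0 < mu <= 2 -> 0 <= rho -> rho `^ mu = e -> Gt_dom n mu z ->
  (forall j, normc (z 0 (lift ord0 j)) <= 37 * rho) ->
  forall x : R, 1369 * n%:R * e <= x -> z 0 ord0 <> x%:C.
Proof.
move=> hmu rho0 rhoE [_ zG] zs x xA z0; move: zG; rewrite z0 /= normr0 powR0.
  rewrite add0r ltNge (le_trans _ xA) //.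
  by apply: (sum_powR_le hmu rho0 rhoE) => j; rewrite normc_ge0 zs.
by case/andP: hmu => mu0 _; rewrite gt_eqF.
Qed.

Lemma Gt_dom_disc_bound (R : realType) n (mu rho e r : R) phi (a : R[i]) :
  0 < mu <= 2 -> 0 <= rho -> rho `^ mu = e -> 0 < r <= 1 ->
  holomorphic_disc (Gt_dom n mu) phi ->
  (forall w j, normc w < r -> normc (phi w 0 (lift ord0 j)) <= 37 * rho) ->
  normc a <= r / 288 ->
  normc (phi a 0 ord0 - phi 0 0 ord0) <=
    2304 / r * normc a * normc ((1369 * n%:R * e)%:C - phi 0 0 ord0).
Proof.
move=> hmu rho0 rhoE /andP[r0 r1] hphi phis ar.
have lt1 w : normc w < r -> normc w < 1 by move=> /lt_le_trans; apply.
apply: (@slit_bound R (fun x => phi x 0 ord0) r) => // w wr.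
  exact: holomorphic_disc_cderivable hphi (lt1 _ wr).
apply: (Gt_dom_slit hmu rho0 rhoE); first by have [] := hphi w (lt1 _ wr).
by move=> j; exact: phis.
Qed.

Lemma pt_ord0 (R : realType) n (t : R) : pt n t 0 ord0 = (- t)%:C.
Proof. by rewrite mxE eqxx. Qed.

Lemma pt_lift (R : realType) n (t : R) j : pt n t 0 (lift ord0 j) = 0.
Proof. by rewrite mxE -(inj_eq val_inj) /=. Qed.

Lemma pt_dist (R : realType) n (d e : R) : d <= e ->
  normc (pt n e 0 ord0 - pt n d 0 ord0) = e - d.
Proof.
move=> de; rewrite !pt_ord0 -rmorphB normc_real.
have -> : - e - - d = - (e - d) by ring.
by rewrite normrN ger0_norm // subr_ge0.
Qed.

(** Both factors |w| and |w - a| are O(rho), and 37 >= 288 * (1/4) * (1/2);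
    the constant is the one of the bound along a chain. *)
Lemma holomorphic_disc_two_zeros (R : realType) n (M : set 'rV[R[i]]_n.+1) phi j
    (a w : R[i]) (rho : R) :
  in_polydisc M -> holomorphic_disc M phi -> phi 0 0 j = 0 -> phi a 0 j = 0 ->
  a != 0 -> 0 < rho <= 1 -> normc a <= rho / 4 -> normc w <= rho / 4 ->
  normc (phi w 0 j) <= 37 * rho ^+ 2.
Proof.
move=> MD hphi phi0 phia a0 /andP[rho0 rho1] ar wr.
have dphi x : normc x < 1 -> cderivable (fun x => phi x 0 j) x.
  exact: holomorphic_disc_cderivable hphi.
have phi1 x : normc x < 1 -> normc (phi x 0 j) <= 1.
  by move=> x1; apply: ltW; apply: MD; have [] := hphi x x1.
have [a4 w4] : normc a <= 4^-1 /\ normc w <= 4^-1 by split; lra.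
apply: (le_trans (schwarz_two_zeros dphi phi1 phi0 phia a0 a4 w4)).
have : normc w * normc (w - a) <= rho / 4 * (rho / 2).
  apply: ler_pM; rewrite ?normc_ge0 //.
  by apply: (le_trans (normcD _ _)); rewrite normcN; lra.
have := sqr_ge0 rho; rewrite expr2; lra.
Qed.

(** The discs are studied on the radius rho / 4 with rho = eps^(1/(2 mu)). A
    parameter a beyond rho / 1152 is large enough by itself; otherwise the
    coordinates other than the first, which vanish at 0 and at a, are at most
    37 rho^2 = 37 eps^(1/mu) there. *)
Lemma lempert_Gt_dom_ge (R : realType) n (mu d e : R) : 0 < mu <= 2 ->
  0 < d < e -> e <= 2^-1 ->
  (((e - d) * e `^ (1 / (2 * mu)) / e / (9216 * (1369 * n%:R + 1)))%:E <=
   lempert (Gt_dom n mu) (pt n d) (pt n e))%E.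
Proof.
move=> hmu /andP[d0 de] e2; have /andP[mu0 mu2] := hmu.
have e0 : 0 < e by lra.
pose rho := e `^ (1 / (2 * mu)); rewrite -/rho.
have rho0 : 0 < rho by exact: powR_gt0.
have rho1 : rho <= 1.
  by apply: powR_le1; [lra | rewrite divr_ge0 // mulr_ge0 // ltW].
have rhoE : (rho ^+ 2) `^ mu = e.
  rewrite -powR_mulrn ?ltW // /rho -!powRrM.
  have -> : 1 / (2 * mu) * (2%:R * mu) = 1 by field; lra.
  by rewrite powRr1 // ltW.
have lt_e : (e - d) * rho / e <= rho.
  by rewrite ler_pdivrMr // mulrC ler_wpM2l ?ltW //; lra.
apply: lempert_ge => a phi a1 hphi phi0 phia.
have a00 : a != 0.
  apply/eqP => a0; have := pt_dist n (ltW de).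
  by rewrite -phi0 -phia a0 subrr normc0; lra.
(* 1152 = 4 * 288: below this radius the bound on the first coordinate applies
   to discs of radius rho / 4 *)
have near_a : normc a <= rho / 1152 ->
    e - d <= 2304 / (rho / 4) * normc a * (1369 * n%:R * e + d).
  move=> asmall; have a4 : normc a <= rho / 4 by lra.
  have rho01 : 0 < rho <= 1 by rewrite rho0.
  have small w j : normc w < rho / 4 ->
      normc (phi w 0 (lift ord0 j)) <= 37 * rho ^+ 2.
    move/ltW; apply: (holomorphic_disc_two_zeros (a := a) _ hphi) => //.
    - exact: Gt_dom_in_polydisc.
    - by rewrite phi0 pt_lift.
    - by rewrite phia pt_lift.
  have r01 : 0 < rho / 4 <= 1 by lra.
  have a288 : normc a <= rho / 4 / 288 by lra.
  have := Gt_dom_disc_bound hmu (sqr_ge0 rho) rhoE r01 hphi small a288.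
  rewrite phi0 phia (pt_dist n (ltW de)) pt_ord0 -rmorphB normc_real opprK.
  suff A_ge0 : 0 <= 1369 * n%:R * e + d by rewrite (ger0_norm A_ge0).
  apply: addr_ge0; last exact: ltW.
  by apply: mulr_ge0; [apply: mulr_ge0; rewrite ler0n | exact: ltW].
have n0 := ler0n R n; have c1 : 1 <= 1369 * n%:R + 1 :> R by lra.
have AN : 1369 * n%:R * e + d <= (1369 * n%:R + 1) * e.
  by rewrite [leRHS]mulrDl mul1r; apply: lerD => //; exact: ltW.
move: (1369 * n%:R * e) (1369 * n%:R + 1) c1 AN near_a => A N c1 AN near_a.
have N0 : 0 < N by exact: lt_le_trans c1.
have cN0 : 0 < 9216 * N by apply: mulr_gt0; [rewrite ltr0n|exact: N0].
have na0 := normc_ge0 a; have r4 : 0 < rho / 4 by rewrite divr_gt0.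
rewrite (ler_pdivrMr _ _ cN0).
have [abig|/near_a h] := ltP (rho / 1152) (normc a).
  apply: (le_trans lt_e).
  have : normc a * 9216 * 1 <= normc a * 9216 * N.
    by apply: ler_wpM2l c1; apply: mulr_ge0 na0 _; rewrite ler0n.
  move: abig; clear -rho0; lra.
rewrite ler_pdivrMr // -ler_pdivlMr //; apply: (le_trans h).
apply: (@le_trans _ _ (2304 / (rho / 4) * normc a * (N * e))).
  apply: ler_wpM2l AN; apply: mulr_ge0 na0.
  by apply: divr_ge0 _ (ltW r4); rewrite ler0n.
rewrite le_eqVlt; apply/orP; left; apply/eqP.
by field; rewrite gt_eqF.
Qed.

(** Infinitesimal form of the lower bound along a chain: as long as the other
    coordinates of z are below rho = eps^(1/mu), they remain below 37 rho on
    the disc of radius rho / 4, since 144 / 4 + 1 = 37. *)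
Lemma lempert_Gt_dom_step (R : realType) n (mu rho e l : R)
    (z w : 'rV[R[i]]_n.+1) :
  0 < mu <= 2 -> 0 < rho <= 1 -> rho `^ mu = e -> Gt_dom n mu z ->
  (forall j, normc (z 0 (lift ord0 j)) <= rho) ->
  lempert (Gt_dom n mu) z w = l%:E -> l < rho / 1152 ->
  normc (w 0 ord0 - z 0 ord0) <=
    9216 / rho * normc ((1369 * n%:R * e)%:C - z 0 ord0) * l.
Proof.
move=> hmu rho01 rhoE zG zs lE lsmall; have /andP[rho0 rho1] := rho01.
have near_a a phi : holomorphic_disc (Gt_dom n mu) phi -> phi 0 = z -> phi a = w ->
    normc a <= rho / 4 / 288 ->
    normc (w 0 ord0 - z 0 ord0) <= 2304 / (rho / 4) * normc a *
      normc ((1369 * n%:R * e)%:C - z 0 ord0).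
  move=> hphi phi0 phia asmall.
  have small x j : normc x < rho / 4 -> normc (phi x 0 (lift ord0 j)) <= 37 * rho.
    move=> xr; have x1 : normc x < 1 by move: xr rho1 rho0; clear; lra.
    have GD := @Gt_dom_in_polydisc R n mu.
    have := holomorphic_disc_schwarz (lift ord0 j) GD hphi x1.
    rewrite phi0 => h; rewrite -(subrK (z 0 (lift ord0 j)) (phi x 0 _)).
    apply: (le_trans (normcD _ _)); move: h (zs j) xr rho0; clear; lra.
  have r01 : 0 < rho / 4 <= 1 by move: rho0 rho1; clear; lra.
  have := Gt_dom_disc_bound hmu (ltW rho0) rhoE r01 hphi small asmall.
  by rewrite phi0 phia.
have U0 : 0 < normc ((1369 * n%:R * e)%:C - z 0 ord0).
  have zs' j : normc (z 0 (lift ord0 j)) <= 37 * rho.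
    by move: (zs j) rho0; clear; lra.
  have slit := Gt_dom_slit hmu (ltW rho0) rhoE zG zs'.
  rewrite normc_gt0 subr_eq0; apply/eqP => E.
  by apply: (slit _ (lexx _)); rewrite E.
move: (normc (_%:C - _)) U0 near_a => U U0 near_a.
have K_gt0 : 0 < 9216 :> R by rewrite ltr0n.
have K0 : 0 < 9216 / rho * U by exact: mulr_gt0 (divr_gt0 K_gt0 rho0) U0.
move: near_a; set D := normc (w 0 ord0 - _) => near_a.
suff : ((Num.min (rho / 1152) (D / (9216 / rho * U)))%:E <= l%:E)%E.
  rewrite lee_fin ge_min => /orP[|]; first by rewrite leNgt lsmall.
  by rewrite ler_pdivrMr // [l * _]mulrC.
rewrite -lE; apply: lempert_ge => a phi a1 hphi phi0 phia.
rewrite ge_min; have [//|asmall] /= := leP (rho / 1152) (normc a).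
have a4 : normc a <= rho / 4 / 288 by move: asmall rho0; clear; lra.
rewrite (ler_pdivrMr _ _ K0); apply: (le_trans (near_a a phi hphi phi0 phia a4)).
rewrite le_eqVlt; apply/orP; left; apply/eqP.
by field; rewrite gt_eqF.
Qed.

(** The increments are bounded by K l_k |A - p_k|, and this distance at most
    doubles while K times the sum of the l_j stays below 1/2. *)
Lemma discrete_gronwall (R : realType) (A : R[i]) (p : nat -> R[i]) (l : nat -> R)
    (K U : R) (m : nat) :
  0 <= K -> (forall j, 0 <= l j) -> U = normc (A - p 0%N) ->
  K * (\sum_(j < m) l j) <= 1 / 2 ->
  (forall k, (k < m)%N ->
     normc (p k.+1 - p k) <= K * normc (A - p k) * l k) ->
  normc (p m - p 0%N) <= 2 * (K * (\sum_(j < m) l j)) * U.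
Proof.
move=> K0 l0 UE; have U0 : 0 <= U by rewrite UE normc_ge0.
elim: m => [|m IH] Km H; first by rewrite subrr normc0 big_ord0 !mulr0 mul0r.
move: Km; rewrite big_ord_recr /=; set s := \sum_(j < m) l j => Km.
have Kl : 0 <= K * l m by rewrite mulr_ge0.
have Ks : K * s <= 1 / 2 by lra.
have {}IH := IH Ks (fun k km => H k (ltnW km)); rewrite -/s in IH.
have Um : normc (A - p m) <= 2 * U.
  have -> : A - p m = (A - p 0%N) - (p m - p 0%N) by ring.
  apply: (le_trans (normcD _ _)); rewrite normcN -UE.
  have : K * s * U <= 1 / 2 * U by apply: ler_wpM2r.
  lra.
have -> : p m.+1 - p 0%N = (p m - p 0%N) + (p m.+1 - p m) by ring.
apply: (le_trans (normcD _ _)).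
have := H m (ltnSn m).
have : K * l m * normc (A - p m) <= K * l m * (2 * U) by apply: ler_wpM2l.
lra.
Qed.

(** A link of infinite length would make the whole sum infinite, so below a
    real bound the lengths of the links are real numbers. *)
Lemma sum_lempert_lt (R : realType) n (M : set 'rV[R[i]]_n.+1)
    (y : nat -> 'rV[R[i]]_n.+1) m (c : R) :
  (\sum_(j < m) lempert M (y j) (y j.+1) < c%:E)%E ->
  exists l : nat -> R, [/\ forall j, 0 <= l j,
    forall j, (j < m)%N -> lempert M (y j) (y j.+1) = (l j)%:E &
    \sum_(j < m) l j < c].
Proof.
pose L (j : nat) := lempert M (y j) (y j.+1) => S_lt.
have L_le j : (j < m)%N -> (L j <= \sum_(i < m) L i)%E.
  move=> jm; rewrite (bigD1 (Ordinal jm)) //= leeDl //.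
  by apply: sume_ge0 => i _; exact: lempert_ge0.
have lE j : (j < m)%N -> L j = (fine (L j))%:E.
  move=> jm; rewrite fineK // ge0_fin_numE ?lempert_ge0 //.
  by apply: le_lt_trans (L_le j jm) (lt_trans S_lt (ltry _)).
exists (fun j => fine (L j)); split=> // [j|].
  by apply: fine_ge0; exact: lempert_ge0.
rewrite -lte_fin -sumEFin (eq_bigr (fun j : 'I_m => L j)) // => j _.
by rewrite -lE.
Qed.

(** If the chain were shorter than the bound, it would be shorter than rho /
    18432 with rho = eps^(1/mu); then all its points have small other
    coordinates, the step estimate applies to every link, and the discrete
    Gronwall inequality bounds eps - delta by the length of the chain, a
    contradiction. *)
Lemma lempert_chain_Gt_dom_ge (R : realType) n (mu d e : R) m : 0 < mu <= 2 ->
  0 < d < e -> e <= 2^-1 ->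
  (((e - d) * e `^ (1 / mu) / e / (18432 * (1369 * n%:R + 1)))%:E <=
   lempert_chain (Gt_dom n mu) m (pt n d) (pt n e))%E.
Proof.
move=> hmu /andP[d0 de] e2; have /andP[mu0 mu2] := hmu.
have e0 : 0 < e by lra.
pose rho := e `^ (1 / mu); rewrite -/rho.
have rho0 : 0 < rho by exact: powR_gt0.
have rho01 : 0 < rho <= 1.
  by rewrite rho0; apply: powR_le1; [lra | rewrite divr_ge0 // ltW].
have rhoE : rho `^ mu = e by rewrite /rho -powRrM divfK ?gt_eqF // powRr1 // ltW.
have lt_e : (e - d) * rho / e <= rho.
  by rewrite ler_pdivrMr // mulrC ler_wpM2l ?ltW //; lra.
have n0 := ler0n R n; have c1 : 1 <= 1369 * n%:R + 1 :> R by lra.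
pose A := 1369 * n%:R * e; pose U0 := normc (A%:C - pt n d 0 ord0).
have U0_le : U0 <= (1369 * n%:R + 1) * e.
  have ne0 : 0 <= n%:R * e by rewrite mulr_ge0 // ltW.
  rewrite /U0 pt_ord0 -rmorphB normc_real opprK ger0_norm /A; lra.
have U0_ge0 : 0 <= U0 by exact: normc_ge0.
move: (1369 * n%:R + 1) c1 U0_le => N c1 U0_le.
have N0 : 0 < N by exact: lt_le_trans c1.
have K_gt0 : 0 < 9216 :> R by rewrite ltr0n.
have cN0 : 0 < 18432 * N by apply: mulr_gt0; [rewrite ltr0n|exact: N0].
apply: le_ereal_inf_tmp => _ [y [yG y0 ym] <-].
rewrite leNgt; apply/negP => /sum_lempert_lt[l [l0 lE sm_lt]].
have s_le k : (k <= m)%N -> \sum_(j < k) l j <= \sum_(j < m) l j.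
  move=> /subnKC <-; elim: (m - k)%N => [|i IH]; first by rewrite addn0.
  by rewrite addnS big_ord_recr /= (le_trans IH) // lerDl.
have sE k : (k <= m)%N ->
    (\sum_(i < k) lempert (Gt_dom n mu) (y i) (y i.+1))%E = (\sum_(j < k) l j)%:E.
  move=> km; rewrite -sumEFin; apply: eq_bigr => i _; apply: lE.
  exact: leq_trans km.
have sm_rho : \sum_(j < m) l j < rho / 18432.
  apply: (lt_le_trans sm_lt); rewrite ler_pdivrMr // mulrA divfK ?gt_eqF ?ltr0n //.
  by apply: (le_trans lt_e); rewrite ler_peMr // ltW.
have s0 k : 0 <= \sum_(j < k) l j by apply: sumr_ge0.
have z_small k j : (k < m)%N -> normc (y k 0 (lift ord0 j)) <= rho.
  move=> km.
  have := sum_lempert_ge_dist y k (lift ord0 j) (@Gt_dom_in_polydisc R n mu).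
  rewrite (sE k (ltnW km)) lee_fin y0 pt_lift subr0.
  by move: (s_le k (ltnW km)) sm_rho; clear -rho0; lra.
have lk k : (k < m)%N -> l k < rho / 1152.
  move=> /s_le; rewrite big_ord_recr /=; move: (s0 k) sm_rho; clear -rho0; lra.
have step k : (k < m)%N ->
    normc (y k.+1 0 ord0 - y k 0 ord0) <=
      9216 / rho * normc (A%:C - y k 0 ord0) * l k.
  move=> km; apply: (lempert_Gt_dom_step hmu rho01 rhoE) => //.
  - exact: yG (ltnW km).
  - by move=> j; exact: z_small.
  - exact: lE.
  - exact: lk.
have Kge0 : 0 <= 9216 / rho by exact: divr_ge0 (ltW K_gt0) (ltW rho0).
have Ks : 9216 / rho * (\sum_(j < m) l j) <= 1 / 2.
  rewrite -mulrA [_^-1 * _]mulrC mulrA ler_pdivrMr //.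
  by move: sm_rho; clear -rho0; lra.
have := @discrete_gronwall R A%:C (fun k => y k 0 ord0) l (9216 / rho) U0 m Kge0 l0.
rewrite y0 ym => /(_ erefl Ks step); rewrite (pt_dist n (ltW de)) => h.
move: sm_lt; rewrite ltNge => /negP; apply.
rewrite ler_pdivrMr // ler_pdivrMr // -ler_pdivlMr //.
apply: (le_trans h).
have K0 : 0 <= 2 * (9216 / rho * \sum_(j < m) l j).
  by apply: mulr_ge0; [rewrite ler0n|exact: mulr_ge0 Kge0 (s0 m)].
apply: (le_trans (ler_wpM2l K0 U0_le)).
rewrite le_eqVlt; apply/orP; left; apply/eqP.
by field; rewrite gt_eqF.
Qed.

(** * Discs in G *)

Lemma le_powR_half (R : realType) (q w : R) : 0 <= q -> q ^+ 2 <= w -> q <= w `^ 2^-1.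
Proof.
move=> q0 qw; rewrite powR12_sqrt ?(le_trans _ qw) ?sqr_ge0 //.
by have := ler_wsqrtr qw; rewrite sqrtr_sqr ger0_norm.
Qed.

(** With the two lemmas that follow: lower bounds for w^mu by the extreme
    powers allowed by the range of mu, which is all that is used about mu once
    lengths are normalised. *)
Lemma powR_ge_small (R : realType) (mu q w : R) : 0 < mu <= 2^-1 ->
  0 <= q -> q ^+ 2 <= w -> w <= 1 -> q <= w `^ mu.
Proof.
move=> /andP[mu0 mu2] q0 qw w1.
have [w0|w0] := leP w 0.
  have : q ^+ 2 <= 0 by apply: le_trans w0.
  rewrite exprn_even_le0 //= => /eqP ->; exact: powR_ge0.
apply: (@le_trans _ _ (w `^ 2^-1)); last by apply: ger_powR; rewrite ?w0.
exact: le_powR_half.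
Qed.

Lemma powR_ge_mid (R : realType) (mu q w : R) : 2^-1 <= mu <= 1 ->
  0 <= q -> q <= w -> q ^+ 2 <= w -> q <= w `^ mu.
Proof.
move=> /andP[mu1 mu2] q0 qw q2w.
have [w1|w1] := leP 1 w.
  apply: (@le_trans _ _ (w `^ 2^-1)); last by apply: ler_powR.
  exact: le_powR_half.
have [w0|w0] := leP w 0; first by rewrite (le_trans (le_trans qw w0)) ?powR_ge0.
by apply: (le_trans qw); apply: ger1_powR => //; rewrite w0 ltW.
Qed.

Lemma powR_ge_large (R : realType) (mu q w : R) : 1 <= mu <= 2 ->
  0 <= w -> q <= w -> q <= w ^+ 2 -> q <= w `^ mu.
Proof.
move=> /andP[mu1 mu2] w0 qw qw2.
have [w1|w1] := leP 1 w; first by apply: (le_trans qw); exact: le1r_powR.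
have [w00|w00] := leP w 0; first by rewrite (le_trans (le_trans qw w00)) ?powR_ge0.
apply: (le_trans qw2); rewrite -powR_mulrn //.
by apply: ger_powR => //; rewrite w00 ltW.
Qed.

(** Only the first two coordinates move: the discs that prove the upper bounds
    live in a two-dimensional slice. *)
Definition disc2 (R : realType) n (f g : R[i] -> R[i]) (z : R[i]) : 'rV[R[i]]_n.+2 :=
  \row_j (if j == ord0 then f z else if j == lift ord0 ord0 then g z else 0).

Lemma holomorphic_disc2 (R : realType) n (mu : R) (f g : R[i] -> R[i]) :
  0 < mu ->
  (forall z, cderivable g z) ->
  (forall z, normc z < 1 -> [/\ cderivable f z, normc (f z) < 1, normc (g z) < 1
     & complex.Re (f z) < normc (g z) `^ mu]) ->
  holomorphic_disc (G_dom n.+1 mu) (disc2 n f g).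
Proof.
move=> mu0 dg H z z1; have [df f1 g1 fg] := H z z1; split; [split|].
- move=> j; rewrite mxE /disc /=; case: ifP => // _; case: ifP => // _.
  by rewrite normc0.
- rewrite mxE eqxx (lt_le_trans fg) // (bigD1 ord0) //= mxE eqxx lerDl.
  by apply: sumr_ge0 => j _; exact: powR_ge0.
move=> j; apply/cderivableP; have [->|j0] := eqVneq j ord0.
  rewrite (_ : (fun x => _) = f); first exact df.
  by apply/funext => x; rewrite mxE eqxx.
have [->|j1] := eqVneq j (lift ord0 ord0).
  rewrite (_ : (fun x => _) = g); first exact (dg z).
  by apply/funext => x; rewrite mxE eqxx.
rewrite (_ : (fun x => _) = (fun=> 0)); first exact (cderivable_cst 0 z).
by apply/funext => x; rewrite mxE (negPf j0) (negPf j1).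
Qed.

Lemma disc2_pt (R : realType) n (f g : R[i] -> R[i]) (z : R[i]) (t : R) :
  f z = (- t)%:C -> g z = 0 -> disc2 n f g z = pt n.+1 t.
Proof.
move=> fz gz; apply/rowP => j; rewrite !mxE fz gz.
by case: ifP => // _; case: ifP.
Qed.

Lemma lempert_le (R : realType) n (M : set 'rV[R[i]]_n.+1) (z w : 'rV[R[i]]_n.+1)
    (a : R[i]) phi :
  normc a < 1 -> holomorphic_disc M phi -> phi 0 = z -> phi a = w ->
  (lempert M z w <= (normc a)%:E)%E.
Proof.
move=> a1 hphi phi0 phia; apply: ereal_inf_lbound.
by exists a => //; split => //; exists phi.
Qed.

(** The first coordinate is - d / (1 - (1 - d) z), which maps the disc into
    the left half of the unit disc; the other coordinates stay at 0. *)
Lemma lempert_G_dom_le1 (R : realType) n (mu d e : R) : 0 < mu ->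
  0 < d < e -> e <= 2^-1 ->
  (lempert (G_dom n.+1 mu) (pt n.+1 d) (pt n.+1 e) <= 1%:E)%E.
Proof.
move=> mu0 /andP[d0 de] e2; have e0 : 0 < e by lra.
pose c := 1 - d; have c0 : 0 < c by rewrite /c; lra.
pose f (z : R[i]) := (- d)%:C * (1 - c%:C * z)^-1.
pose a := (1 - d / e) / c.
have a0 : 0 <= a by apply: divr_ge0; [rewrite subr_ge0 ler_pdivrMr //; lra|lra].
have a1 : a < 1.
  rewrite ltr_pdivrMr // mul1r /c ltrD2l ltrN2 ltr_pdivlMr // gtr_pMr //; lra.
have ReB z : normc z < 1 -> d < complex.Re (1 - c%:C * z).
  move=> z1; have := le_lt_trans (ler_norm _) (le_lt_trans (normc_Re z) z1).
  case: (z) => x y /= x1; rewrite mul0r subr0.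
  have : c * x < c * 1 by rewrite ltr_pM2l.
  rewrite /c; lra.
have den z : normc z < 1 -> d < normc (1 - c%:C * z).
  by move=> /ReB h; apply: lt_le_trans h (le_trans (ler_norm _) (normc_Re _)).
have hphi : holomorphic_disc (G_dom n.+1 mu) (disc2 n f (fun=> 0)).
  apply: holomorphic_disc2 => // [z|z z1]; first exact: cderivable_cst.
  have dz := den z z1; have n0 : 1 - c%:C * z != 0 by rewrite -normc_gt0; lra.
  split; rewrite ?normc0 ?powR0 ?gt_eqF //.
  - apply: (@cderivableM R (fun=> (- d)%:C) (fun z => (1 - c%:C * z)^-1)).
      exact: cderivable_cst.
    apply: (@cderivableV R (fun z => 1 - c%:C * z)); first exact: n0.
    apply: (@cderivableB R (fun=> 1)); first exact: cderivable_cst.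
    apply: (@cderivableM R (fun=> c%:C) id); first exact: cderivable_cst.
    exact: cderivable_id.
  - by rewrite normcM normcV normc_real normrN gtr0_norm // ltr_pdivrMr ?mul1r //; lra.
  have := ReB z z1; rewrite /f; case: (1 - c%:C * z) => x y /= xd.
  rewrite mul0r subr0 mulNr oppr_lt0 mulr_gt0 // divr_gt0 //; first lra.
  by rewrite ltr_pwDl ?sqr_ge0 // exprn_gt0 //; lra.
have na : normc a%:C = a by rewrite normc_real ger0_norm.
apply: (@le_trans _ _ (normc a%:C)%:E).
  apply: (lempert_le _ hphi); first by rewrite na.
    by apply: disc2_pt => //; rewrite /f mulr0 subr0 invr1 mulr1.
  apply: disc2_pt => //; rewrite /f -rmorphM -(rmorph1 (real_complex R)) -rmorphB.
  rewrite -fmorphV -rmorphM; congr _%:C.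
  have -> : c * a = 1 - d / e by rewrite /a mulrC divfK ?gt_eqF.
  by rewrite subKr invf_div mulrC -mulrA mulrN mulVf ?gt_eqF // mulrN1.
by rewrite na lee_fin ltW.
Qed.

(** In the hypothesis x, y and v stand for |z|, |z - a| and the real part of
    the first coordinate - d - s z, written around either of the two
    parameters. *)
Lemma lempert_G_dom_affine (R : realType) n (mu s d e : R) : 0 < mu ->
  0 < d < e -> e <= 2^-1 -> 0 < s <= 2^-1 -> (e - d) / s < 1 ->
  (forall x y v : R, 0 <= x < 1 -> 0 <= y -> y <= x + (e - d) / s ->
     x <= y + (e - d) / s -> v < s * x -> v <= - e + s * y ->
     v < (x * y / 2) `^ mu) ->
  (lempert (G_dom n.+1 mu) (pt n.+1 d) (pt n.+1 e) <= ((e - d) / s)%:E)%E.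
Proof.
move=> mu0 /andP[d0 de] e2 /andP[s0 s2]; set a := (e - d) / s => a1 ineq.
have a0 : 0 < a by apply: divr_gt0 => //; rewrite subr_gt0.
have sa : s * a = e - d by rewrite mulrC divfK ?gt_eqF.
pose f (z : R[i]) := (- d)%:C - s%:C * z.
pose g (z : R[i]) := (2^-1)%:C * (z * (z - a%:C)).
have na : normc a%:C = a by rewrite normc_real gtr0_norm.
have hphi : holomorphic_disc (G_dom n.+1 mu) (disc2 n f g).
  apply: holomorphic_disc2 => // [z|z z1].
    apply: (@cderivableM R (fun=> _)); first exact: cderivable_cst.
    apply: (@cderivableM R id); first exact: cderivable_id.
    by apply: (@cderivableB R id); [exact: cderivable_id|exact: cderivable_cst].
  have x0 := normc_ge0 z; have y0 := normc_ge0 (z - a%:C).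
  have yx : normc (z - a%:C) <= normc z + a.
    by apply: (le_trans (normcD _ _)); rewrite normcN na.
  have xy : normc z <= normc (z - a%:C) + a.
    by rewrite -{1}(subrK a%:C z); apply: (le_trans (normcD _ _)); rewrite na.
  have ng : normc (g z) = normc z * normc (z - a%:C) / 2.
    rewrite /g !normcM normc_real gtr0_norm ?invr_gt0 // mulrC //.
  split.
  - apply: (@cderivableB R (fun=> _)); first exact: cderivable_cst.
    by apply: (@cderivableM R (fun=> _) id); [exact: cderivable_cst|exact: cderivable_id].
  - apply: (le_lt_trans (normcD _ _)); rewrite normcN normcM !normc_real normrN.
    rewrite !gtr0_norm //.
    have : s * normc z <= s * 1 by rewrite ler_wpM2l ?ltW.
    lra.
  - rewrite ng; have : normc z * normc (z - a%:C) <= 1 * normc (z - a%:C).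
      by rewrite ler_wpM2r // ltW.
    lra.
  rewrite ng; apply: ineq => //; first by rewrite x0.
    have : `|complex.Re z| <= normc z := normc_Re z.
    rewrite ler_norml => /andP[h _]; rewrite /f.
    have : s * (- normc z) <= s * complex.Re z by apply: ler_wpM2l; [exact: ltW|].
    case: (z) => x y /=; rewrite mul0r subr0; lra.
  have : `|complex.Re (z - a%:C)| <= normc (z - a%:C) := normc_Re _.
  rewrite ler_norml => /andP[h _]; rewrite /f.
  have : s * (- normc (z - a%:C)) <= s * complex.Re (z - a%:C).
    by apply: ler_wpM2l; [exact: ltW|].
  move: sa; move: (normc (z - a%:C)) => N; case: (z) => x y /=; rewrite mul0r subr0; lra.
rewrite -[a in (_ <= a%:E)%E]na; apply: (lempert_le _ hphi); first by rewrite na.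
  by apply: disc2_pt; rewrite /f /g ?mulr0 ?subr0 // mul0r mulr0.
apply: disc2_pt; rewrite /f /g ?subrr ?mulr0 //.
by rewrite -rmorphM -rmorphB sa; congr _%:C; ring.
Qed.

(** The first coordinate is - d - q z^2 with q a^2 = e - d. Near a the real
    part of z^2 is positive, so only |z - a| >= a / 4 needs the second
    coordinate. *)
Lemma lempert_G_dom_quadratic (R : realType) n (mu a d e : R) : 0 < mu ->
  0 < d < e -> e <= 2^-1 -> 0 < a < 1 -> (e - d) / a ^+ 2 <= 2^-1 ->
  (forall x y : R, 0 <= x -> x <= y + a -> a / 4 <= y ->
     (e - d) / a ^+ 2 * x ^+ 2 <= (x * y / 2) `^ mu) ->
  (lempert (G_dom n.+1 mu) (pt n.+1 d) (pt n.+1 e) <= a%:E)%E.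
Proof.
move=> mu0 /andP[d0 de] e2 /andP[a0 a1]; set q := (e - d) / a ^+ 2 => q2 ineq.
have qa : q * (a * a) = e - d by rewrite -expr2 divfK // gt_eqF // exprn_gt0.
have q0 : 0 < q by apply: divr_gt0; rewrite ?subr_gt0 ?exprn_gt0.
pose f (z : R[i]) := (- d)%:C - q%:C * (z * z).
pose g (z : R[i]) := (2^-1)%:C * (z * (z - a%:C)).
have na : normc a%:C = a by rewrite normc_real gtr0_norm.
have hphi : holomorphic_disc (G_dom n.+1 mu) (disc2 n f g).
  apply: holomorphic_disc2 => // [z|z z1].
    apply: (@cderivableM R (fun=> _)); first exact: cderivable_cst.
    apply: (@cderivableM R id); first exact: cderivable_id.
    by apply: (@cderivableB R id); [exact: cderivable_id|exact: cderivable_cst].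
  have x0 := normc_ge0 z; have y0 := normc_ge0 (z - a%:C).
  have yx : normc (z - a%:C) <= normc z + a.
    by apply: (le_trans (normcD _ _)); rewrite normcN na.
  have xy : normc z <= normc (z - a%:C) + a.
    by rewrite -{1}(subrK a%:C z); apply: (le_trans (normcD _ _)); rewrite na.
  have ng : normc (g z) = normc z * normc (z - a%:C) / 2.
    rewrite /g !normcM normc_real gtr0_norm ?invr_gt0 // mulrC //.
  have zz1 : normc z * normc z <= 1 by rewrite mulr_ile1 // ltW.
  split.
  - apply: (@cderivableB R (fun=> _)); first exact: cderivable_cst.
    apply: (@cderivableM R (fun=> _)); first exact: cderivable_cst.
    by apply: (@cderivableM R id id); exact: cderivable_id.
  - apply: (le_lt_trans (normcD _ _)); rewrite normcN !normcM !normc_real normrN.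
    rewrite !gtr0_norm //.
    have : q * (normc z * normc z) <= q * 1 by apply: ler_wpM2l; [exact: ltW|].
    lra.
  - rewrite ng; have : normc z * normc (z - a%:C) <= 1 * normc (z - a%:C).
      by rewrite ler_wpM2r // ltW.
    lra.
  rewrite ng; have [ybig|ysmall] := leP (a / 4) (normc (z - a%:C)).
    apply: lt_le_trans (ineq _ _ x0 xy ybig).
    have : `|complex.Re (z * z)| <= normc (z * z) := normc_Re _.
    rewrite ler_norml normcM => /andP[h _]; rewrite /f expr2.
    have : q * (- (normc z * normc z)) <= q * complex.Re (z * z).
      by apply: ler_wpM2l; [exact: ltW|].
    move: (normc z) (z * z) => N [u v] /=; rewrite mul0r subr0; lra.
  (* near the second zero of g the square stays close to a ^ 2 *)
  apply: lt_le_trans (powR_ge0 _ _).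
  have hR := le_trans (normc_Re (z - a%:C)) (ltW ysmall).
  have hI := le_trans (normc_Im (z - a%:C)) (ltW ysmall).
  move: hR hI; rewrite /f; case: (z) => u v /=; rewrite !ler_norml subr0 mul0r subr0.
  move=> /andP[u1 u2] /andP[v1 v2].
  suff : 0 <= q * (u * u - v * v) by lra.
  apply: mulr_ge0; first exact: ltW.
  have : 0 <= (u - v) * (u + v) by apply: mulr_ge0; lra.
  lra.
rewrite -[a in (_ <= a%:E)%E]na; apply: (lempert_le _ hphi); first by rewrite na.
  by apply: disc2_pt; rewrite /f /g ?mul0r ?mulr0 ?subr0.
apply: disc2_pt; rewrite /f /g ?subrr ?mulr0 //.
by rewrite -!rmorphM -rmorphB qa; congr _%:C; ring.
Qed.

Lemma lempert_refl (R : realType) n (M : set 'rV[R[i]]_n.+1) (z : 'rV[R[i]]_n.+1) :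
  M z -> lempert M z z = 0%E.
Proof.
move=> Mz; apply/eqP; rewrite eq_le lempert_ge0 andbT.
have hphi : holomorphic_disc M (fun=> z).
  by move=> w _; split => // j; apply/cderivableP; exact: cderivable_cst.
rewrite -[0%E]/(0%:E) -(normc0 R); apply: (lempert_le _ hphi) => //.
by rewrite normc0.
Qed.

Lemma lempert_chain_le (R : realType) n (M : set 'rV[R[i]]_n.+1) k
    (z y w : 'rV[R[i]]_n.+1) : M z -> M y -> M w ->
  (lempert_chain M k.+2 z w <= lempert M z y + lempert M y w)%E.
Proof.
move=> Mz My Mw.
pose c (j : nat) := if j is j'.+1 then (if j' is 0%N then y else w) else z.
apply: (@le_trans _ _ (\sum_(j < k.+2) lempert M (c j) (c j.+1))%E).
  apply: ereal_inf_lbound; exists c => //; split => //.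
  by case=> [//|[//|j]].
rewrite !big_ord_recl /= big1 ?adde0 // => j _.
by rewrite /c /= lempert_refl.
Qed.

(** The first disc moves the second coordinate to a / 2 with the first one
    fixed; the second disc moves the first coordinate while the second one, (a
    - z) / 2, returns to 0. The second coordinate has a single zero on each
    disc. *)
Lemma lempert_chain_G_dom_two_discs (R : realType) n (mu s d e : R) k : 0 < mu ->
  0 < d < e -> e <= 2^-1 -> 0 < s <= 4^-1 -> (e - d) / s < 1 ->
  (forall t v : R, 0 <= t < 1 -> v <= - e + 2 * s * t -> v < t `^ mu) ->
  (lempert_chain (G_dom n.+1 mu) k.+2 (pt n.+1 d) (pt n.+1 e) <=
   (3 / 2 * ((e - d) / s))%:E)%E.
Proof.
move=> mu0 /andP[d0 de] e2 /andP[s0 s4]; set a := (e - d) / s => a1 ineq.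
have a0 : 0 < a by apply: divr_gt0 => //; rewrite subr_gt0.
have sa : s * a = e - d by rewrite mulrC divfK ?gt_eqF.
pose f1 (z : R[i]) : R[i] := (- d)%:C.
pose f (z : R[i]) := (- d)%:C - s%:C * z.
pose g (z : R[i]) := (2^-1)%:C * (a%:C - z).
have na : normc a%:C = a by rewrite normc_real gtr0_norm.
have na2 : normc (a / 2)%:C = a / 2 by rewrite normc_real gtr0_norm // divr_gt0.
have hphi1 : holomorphic_disc (G_dom n.+1 mu) (disc2 n f1 id).
  apply: holomorphic_disc2 => // [z|z z1]; first exact: cderivable_id.
  split=> //; first exact: cderivable_cst.
    by rewrite normc_real normrN gtr0_norm //; lra.
  by apply: lt_le_trans (powR_ge0 _ _) => /=; lra.
have hphi : holomorphic_disc (G_dom n.+1 mu) (disc2 n f g).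
  apply: holomorphic_disc2 => // [z|z z1].
    apply: (@cderivableM R (fun=> _)); first exact: cderivable_cst.
    by apply: (@cderivableB R (fun=> _) id); [exact: cderivable_cst|exact: cderivable_id].
  have y0 := normc_ge0 (a%:C - z).
  have ng : normc (g z) = normc (a%:C - z) / 2.
    by rewrite /g normcM normc_real gtr0_norm ?invr_gt0 // mulrC.
  have g1 : normc (g z) < 1.
    rewrite ng; have : normc (a%:C - z) <= a + normc z.
      by apply: (le_trans (normcD _ _)); rewrite normcN na.
    lra.
  split=> //.
  - apply: (@cderivableB R (fun=> _)); first exact: cderivable_cst.
    by apply: (@cderivableM R (fun=> _) id); [exact: cderivable_cst|exact: cderivable_id].
  - apply: (le_lt_trans (normcD _ _)); rewrite normcN normcM !normc_real normrN.
    rewrite !gtr0_norm //.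
    have : s * normc z <= s * 1 by rewrite ler_wpM2l ?ltW.
    lra.
  apply: ineq; first by rewrite normc_ge0.
  rewrite ng.
  have : `|complex.Re (a%:C - z)| <= normc (a%:C - z) := normc_Re _.
  rewrite ler_norml => /andP[_ h]; rewrite /f.
  have : s * complex.Re (a%:C - z) <= s * normc (a%:C - z).
    by apply: ler_wpM2l; [exact: ltW|].
  move: sa; move: (normc (a%:C - z)) => N; case: (z) => x y /=; rewrite mul0r subr0; lra.
have inG phi w : holomorphic_disc (G_dom n.+1 mu) phi -> normc w < 1 ->
    G_dom n.+1 mu (phi w) by move=> h w1; have [] := h w w1.
have n01 : normc (0 : R[i]) < 1 by rewrite normc0.
have a21 : normc (a / 2)%:C < 1 by rewrite na2; lra.
have a11 : normc a%:C < 1 by rewrite na.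
have p1 : disc2 n f1 id 0 = pt n.+1 d by apply: disc2_pt.
have p2 : disc2 n f g 0 = disc2 n f1 id (a / 2)%:C.
  apply/rowP => j; rewrite !mxE /f /g /f1 mulr0 !subr0.
  by rewrite -rmorphM mulrC.
have p3 : disc2 n f g a%:C = pt n.+1 e.
  apply: disc2_pt; rewrite /f /g ?subrr ?mulr0 //.
  by rewrite -rmorphM -rmorphB sa; congr _%:C; ring.
have Gd := inG _ _ hphi1 n01; rewrite p1 in Gd.
have Gm := inG _ _ hphi1 a21.
have Ge := inG _ _ hphi a11; rewrite p3 in Ge.
apply: (le_trans (lempert_chain_le k Gd Gm Ge)).
have -> : 3 / 2 * a = normc (a / 2)%:C + normc a%:C by rewrite na na2; lra.
rewrite EFinD; apply: leeD.
  exact: (lempert_le a21 hphi1).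
exact: (lempert_le a11 hphi).
Qed.

Lemma powR_pos_part (R : realType) (e q : R) : 0 < e -> 0 < q ->
  e `^ pos_part (1 - 1 / q) = if q <= 1 then 1 else e / e `^ (1 / q).
Proof.
move=> e0 q0; rewrite /pos_part; have h : (1 - 1 / q <= 0) = (q <= 1).
  by rewrite subr_le0 ler_pdivlMr // mul1r.
case: ifP => q1.
  by rewrite max_r ?h // powRr0.
rewrite max_l; last by rewrite ltW // ltNge h q1.
by rewrite powRB ?powRr1 ?ltW // (gt_eqF e0) implybT.
Qed.

(** Lengths are measured in units of rho = e^(1/(2 mu)), which turns the
    inequalities between powers of e into inequalities free of e. *)
Lemma powR_scale (R : realType) (mu rho e x y : R) : 0 < rho ->
  (rho ^+ 2) `^ mu = e -> 0 <= x -> 0 <= y ->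
  (x * y / 2) `^ mu = e * (x / rho * (y / rho) / 2) `^ mu.
Proof.
move=> rho0 <- x0 y0; rewrite -powRM ?sqr_ge0 //; last first.
  by rewrite !mulr_ge0 // ?invr_ge0 // ltW.
by congr (_ `^ _); field; rewrite gt_eqF.
Qed.

(** Both bounds on v together give v < q with q half the smaller of x and y,
    and q^2 <= x y / 2 <= 1. *)
Lemma affine_ineq_small (R : realType) (mu e x y v : R) : 0 < mu <= 2^-1 ->
  0 < e -> 0 <= x < 1 -> 0 <= y < 2 -> v < 2^-1 * x -> v <= - e + 2^-1 * y ->
  v < (x * y / 2) `^ mu.
Proof.
move=> hmu e0 /andP[x0 x1] /andP[y0 y2] vx vy.
have xy0 := mulr_ge0 x0 y0.
have xy2 : x * y <= 1 * 2 by apply: ler_pM => //; exact: ltW.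
have [xy|xy] := leP x y.
  apply: (lt_le_trans vx); apply: powR_ge_small => //; [lra| |lra].
  have : x * x <= x * y by apply: ler_wpM2l.
  rewrite expr2; lra.
apply: (@lt_le_trans _ _ (2^-1 * y)); first lra.
apply: powR_ge_small => //; [lra| |lra].
have : y * y <= x * y by apply: ler_wpM2r => //; exact: ltW.
rewrite expr2; lra.
Qed.

(** After normalisation v < e q with q half the smaller of u and w, and unless
    v < 0 the larger one is at least 2, so that q and q^2 are both at most u w
    / 2. *)
Lemma affine_ineq_mid (R : realType) (mu rho e x y v : R) : 2^-1 <= mu <= 1 ->
  0 < rho -> (rho ^+ 2) `^ mu = e -> 0 < e -> 0 <= x -> 0 <= y ->
  v < e / rho / 2 * x -> v <= - e + e / rho / 2 * y -> v < (x * y / 2) `^ mu.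
Proof.
move=> hmu rho0 rhoE e0 x0 y0; rewrite (powR_scale rho0 rhoE x0 y0).
have -> : e / rho / 2 * x = e * (x / rho / 2) by ring.
have -> : e / rho / 2 * y = e * (y / rho / 2) by ring.
have : 0 <= x / rho by rewrite divr_ge0 // ltW.
have : 0 <= y / rho by rewrite divr_ge0 // ltW.
move: (x / rho) (y / rho) => u w w0 u0 vu vw.
have [w2|w2] := ltP w 2.
  apply: lt_le_trans (mulr_ge0 (ltW e0) (powR_ge0 _ _)).
  have : e * (w / 2) < e * 1 by rewrite ltr_pM2l //; lra.
  lra.
have uw : u * 2 <= u * w by apply: ler_wpM2l.
have [h|h] := leP u w.
  apply: (lt_le_trans vu); apply: ler_wpM2l; first exact: ltW.
  have : u * u <= u * w by apply: ler_wpM2l.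
  by move=> h2; apply: powR_ge_mid => //; rewrite ?expr2; lra.
apply: (@lt_le_trans _ _ (e * (w / 2))); first lra.
apply: ler_wpM2l; first exact: ltW.
have : w * w <= u * w by apply: ler_wpM2r => //; exact: ltW.
by move=> h2; apply: powR_ge_mid => //; rewrite ?expr2; lra.
Qed.

(** Here w <= u + 1; unless v < 0 one has w >= 2, hence u >= 1, and w / 2 is
    at most u w / 2 and its square. *)
Lemma affine_ineq_large (R : realType) (mu rho e x y v : R) : 1 <= mu <= 2 ->
  0 < rho -> (rho ^+ 2) `^ mu = e -> 0 < e -> 0 <= x -> 0 <= y -> y <= x + rho ->
  v <= - e + e / rho / 2 * y -> v < (x * y / 2) `^ mu.
Proof.
move=> hmu rho0 rhoE e0 x0 y0 yx; rewrite (powR_scale rho0 rhoE x0 y0).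
have -> : e / rho / 2 * y = e * (y / rho / 2) by ring.
have : 0 <= x / rho by rewrite divr_ge0 // ltW.
have : 0 <= y / rho by rewrite divr_ge0 // ltW.
have : y / rho <= x / rho + 1.
  by rewrite ler_pdivrMr // mulrDl divfK ?gt_eqF // mul1r.
move: (x / rho) (y / rho) => u w wu w0 u0 vw.
have [w2|w2] := ltP w 2.
  apply: lt_le_trans (mulr_ge0 (ltW e0) (powR_ge0 _ _)).
  have : e * (w / 2) < e * 1 by rewrite ltr_pM2l //; lra.
  lra.
apply: (@lt_le_trans _ _ (e * (w / 2))); first lra.
apply: ler_wpM2l; first exact: ltW.
have uw : 1 * w <= u * w by apply: ler_wpM2r => //; lra.
apply: powR_ge_large => //; [lra|lra|].
have : 1 * (w / 2) <= (u * w / 2) * (u * w / 2) by apply: ler_pM; lra.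
by rewrite expr2 mul1r.
Qed.

(** After normalisation w >= 4 and u <= 5 w, so u^2 / 512 is at most u w / 2
    and its square; mu <= 2 enters through the square. *)
Lemma quadratic_ineq (R : realType) (mu rho e a q x y : R) : 1 <= mu <= 2 ->
  0 < rho -> (rho ^+ 2) `^ mu = e -> 0 < e -> 16 * rho <= a ->
  q * (512 * rho ^+ 2) <= e ->
  0 <= x -> x <= y + a -> a / 4 <= y -> q * x ^+ 2 <= (x * y / 2) `^ mu.
Proof.
move=> hmu rho0 rhoE e0 a16 qe x0 xy ya; have y0 : 0 <= y by lra.
rewrite (powR_scale rho0 rhoE x0 y0).
have : 4 <= y / rho by rewrite ler_pdivlMr //; lra.
have : x / rho <= 5 * (y / rho).
  by rewrite ler_pdivrMr // -mulrA divfK ?gt_eqF //; lra.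
have : 0 <= x / rho by rewrite divr_ge0 // ltW.
have -> : q * x ^+ 2 = q * (512 * rho ^+ 2) * ((x / rho) ^+ 2 / 512).
  by field; rewrite gt_eqF.
move: (x / rho) (y / rho) => u w u0 uw w4.
apply: (@le_trans _ _ (e * (u ^+ 2 / 512))).
  by apply: ler_wpM2r qe; apply: divr_ge0 (sqr_ge0 u) _; rewrite ler0n.
apply: ler_wpM2l; first exact: ltW.
have uu : u * u <= u * (5 * w) by apply: ler_wpM2l.
have uw0 : 0 <= u * w by apply: mulr_ge0; lra.
have ww : 4 * 4 <= w * w by apply: ler_pM.
have : u * u * (4 * 4) <= u * u * (w * w) by apply: ler_wpM2l => //; exact: mulr_ge0.
have : 0 <= u * u by exact: mulr_ge0.
by move=> h1 h2; apply: powR_ge_large => //; rewrite ?expr2; lra.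
Qed.

(** The affine disc with s = E / 2 covers 2 mu <= 1, mu <= 1 and e / 2 <= d in
    turn; the quadratic one covers the remaining case with a = 32 (e - d) / E.
    *)
Lemma lempert_G_dom_le (R : realType) n (mu d e : R) : 0 < mu <= 2 ->
  0 < d < e -> e <= 2^-1 ->
  (lempert (G_dom n.+1 mu) (pt n.+1 d) (pt n.+1 e) <=
   (32 * ((e - d) / e `^ pos_part (1 - 1 / (2 * mu))))%:E)%E.
Proof.
move=> /andP[mu0 mu2] de e2; have /andP[d0 de'] := de; have e0 : 0 < e by lra.
have mu20 : 0 < 2 * mu by lra.
rewrite (powR_pos_part e0 mu20); set E := if _ then _ else _.
have [X1|X1] := leP 1 (32 * ((e - d) / E)).
  by apply: (le_trans (lempert_G_dom_le1 n mu0 de e2)); rewrite lee_fin.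
have affine (E0 : 0 < E <= 1) :
    (forall x y v : R, 0 <= x < 1 -> 0 <= y -> y <= x + (e - d) / (E / 2) ->
     v < E / 2 * x -> v <= - e + E / 2 * y -> v < (x * y / 2) `^ mu) ->
    (lempert (G_dom n.+1 mu) (pt n.+1 d) (pt n.+1 e) <= (32 * ((e - d) / E))%:E)%E.
  move=> ineq; have /andP[E0' E1] := E0.
  have aE : (e - d) / (E / 2) = 2 * ((e - d) / E) by field; rewrite gt_eqF.
  have X0 : 0 <= (e - d) / E by rewrite divr_ge0 ?ltW // subr_gt0.
  apply: (@le_trans _ _ ((e - d) / (E / 2))%:E); last by rewrite lee_fin aE; lra.
  apply: lempert_G_dom_affine => //; [lra|rewrite aE; lra|].
  by move=> x y v hx hy yx _; exact: ineq.
have [mus|mul] := leP (2 * mu) 1.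
  move: affine; rewrite /E mus => affine; apply: affine; first by rewrite ltr01 lexx.
  move: X1; rewrite /E mus => X1.
  move=> x y v hx y0 yx vx vy; apply: (affine_ineq_small (e := e)) => //; lra.
have muN : (2 * mu <= 1) = false by rewrite leNgt mul.
pose rho := e `^ (1 / (2 * mu)).
have EE : E = e / rho by rewrite /E muN.
have rho0 : 0 < rho by exact: powR_gt0.
have rho1 : rho <= 1 by apply: powR_le1; [lra | rewrite divr_ge0 // ltW].
have rhoE : (rho ^+ 2) `^ mu = e.
  rewrite -powR_mulrn ?ltW // /rho -!powRrM.
  have -> : 1 / (2 * mu) * (2%:R * mu) = 1 by field; lra.
  by rewrite powRr1 // ltW.
have E0 : 0 < E by rewrite EE divr_gt0.
have E1 : E <= 1.
  rewrite EE ler_pdivrMr // mul1r /rho ger1_powR //; first by rewrite e0; lra.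
  by rewrite ler_pdivrMr //; lra.
have [mu1|mu1] := leP mu 1.
  apply: affine; first by rewrite E0.
  move=> x y v /andP[x0 _] y0 _; rewrite EE; apply: affine_ineq_mid => //; lra.
have [de2|de2] := leP (e / 2) d.
  apply: affine; first by rewrite E0.
  move=> x y v /andP[x0 _] y0 yx _; rewrite EE; apply: affine_ineq_large => //; [lra|].
  apply: (le_trans yx); rewrite lerD2l EE.
  have -> : (e - d) / (e / rho / 2) = rho * ((e - d) / (e / 2)).
    by field; rewrite !gt_eqF.
  rewrite ger_pMr // ler_pdivrMr ?divr_gt0 //; lra.
set a := 32 * ((e - d) / E) in X1 *.
have aE : a = (e - d) / (e / 2) * (16 * rho).
  by rewrite /a EE; field; rewrite !gt_eqF.
have a16 : 16 * rho <= a.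
  by rewrite aE ler_peMl ?mulr_ge0 ?ltW // ltr_pdivlMr ?divr_gt0 //; lra.
have a0 : 0 < a by lra.
have qE : (e - d) / a ^+ 2 = e / (32 * rho * a).
  rewrite /a EE; field; rewrite !gt_eqF // subr_gt0 //.
have q512 : (e - d) / a ^+ 2 * (512 * rho ^+ 2) <= e.
  rewrite qE mulrAC ler_pdivrMr; last by do 2 (apply: mulr_gt0 => //).
  apply: ler_wpM2l; first exact: ltW.
  have : 32 * rho * (16 * rho) <= 32 * rho * a by apply: ler_wpM2l => //; lra.
  rewrite expr2; lra.
apply: lempert_G_dom_quadratic => //; first by rewrite a0.
  have e_rho : e <= rho ^+ 2.
    rewrite -[X in X <= _]rhoE; apply: ge1r_powR; last exact: ltW.
    by rewrite exprn_gt0 //= expr_le1 // ltW.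
  have r20 : 0 < rho ^+ 2 by rewrite exprn_gt0.
  have : (e - d) / a ^+ 2 * (512 * rho ^+ 2) <= 1 * rho ^+ 2 by lra.
  by rewrite mulrA ler_pM2r //; lra.
move=> x y x0 xy ya; apply: (quadratic_ineq _ rho0 rhoE e0 a16) => //; lra.
Qed.

(** Two discs with s = E / 4 if the resulting parameter is below 1; otherwise
    the direct disc, followed by constant ones, already satisfies the bound.
    *)
Lemma lempert_chain_G_dom_le (R : realType) n (mu d e : R) k : 0 < mu <= 2 ->
  0 < d < e -> e <= 2^-1 ->
  (lempert_chain (G_dom n.+1 mu) k.+2 (pt n.+1 d) (pt n.+1 e) <=
   (6 * ((e - d) / e `^ pos_part (1 - 1 / mu)))%:E)%E.
Proof.
move=> /andP[mu0 mu2] de e2; have /andP[d0 de'] := de; have e0 : 0 < e by lra.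
rewrite (powR_pos_part e0 mu0); set E := if _ then _ else _.
have ptG t : 0 < t <= 2^-1 -> G_dom n.+1 mu (pt n.+1 t).
  move=> /andP[t0 t2]; split=> [j|].
    rewrite mxE /disc /=; case: ifP => _; last by rewrite normc0.
    by rewrite normc_real normrN gtr0_norm //; lra.
  rewrite pt_ord0 /= (@lt_le_trans _ _ 0) ?oppr_lt0 // sumr_ge0 // => j _.
  exact: powR_ge0.
have [X1|X1] := leP 1 (4 * ((e - d) / E)).
  have Ge : G_dom n.+1 mu (pt n.+1 e) by apply: ptG; lra.
  have Gd : G_dom n.+1 mu (pt n.+1 d) by apply: ptG; lra.
  apply: (le_trans (lempert_chain_le k Gd Ge Ge)); rewrite (lempert_refl Ge) adde0.
  by apply: (le_trans (lempert_G_dom_le1 n mu0 de e2)); rewrite lee_fin; lra.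
suff [E0 ineq] : 0 < E <= 1 /\
    (forall t v : R, 0 <= t < 1 -> v <= - e + 2 * (E / 4) * t -> v < t `^ mu).
  have /andP[E0' E1] := E0.
  have aE : (e - d) / (E / 4) = 4 * ((e - d) / E) by field; rewrite gt_eqF.
  have -> : 6 * ((e - d) / E) = 3 / 2 * ((e - d) / (E / 4)) by rewrite aE; lra.
  by apply: lempert_chain_G_dom_two_discs => //; [lra|rewrite aE].
rewrite /E; case: ifP => [mu1|/negbT]; last rewrite -ltNge => mu1.
  split=> [|t v /andP[t0 t1] vt]; first by rewrite ltr01 lexx.
  have [t00|t00] := leP t 0.
    by apply: lt_le_trans (powR_ge0 _ _); lra.
  have : t <= t `^ mu by apply: ger1_powR => //; rewrite t00 ltW.
  lra.
pose rho := e `^ (1 / mu); rewrite -/rho.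
have rho0 : 0 < rho by exact: powR_gt0.
have rhoE : rho `^ mu = e by rewrite /rho -powRrM divfK ?gt_eqF // powRr1 // ltW.
split=> [|t v /andP[t0 t1]].
  rewrite divr_gt0 //= ler_pdivrMr // mul1r /rho ger1_powR //; first by rewrite e0; lra.
  by rewrite ler_pdivrMr //; lra.
have -> : 2 * (e / rho / 4) * t = e * (t / rho / 2) by field; rewrite gt_eqF.
have -> : t `^ mu = e * (t / rho) `^ mu.
  rewrite -[X in X * _]rhoE -powRM; [|exact: ltW|exact: divr_ge0 t0 (ltW rho0)].
  by rewrite [rho * _]mulrC divfK ?gt_eqF.
have : 0 <= t / rho by exact: divr_ge0 t0 (ltW rho0).
move: (t / rho) => u u0 vu.
have [u1|u1] := leP u 1.
  apply: lt_le_trans (mulr_ge0 (ltW e0) (powR_ge0 _ _)).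
  have : e * (u / 2) <= e * (1 / 2) by apply: ler_wpM2l; lra.
  lra.
have : e * u <= e * u `^ mu by apply: ler_wpM2l; [lra|apply: le1r_powR; lra].
have : 0 <= e * u by rewrite mulr_ge0 // ltW.
lra.
Qed.

(** * Comparison *)

Lemma asymp_of_bounds (R : realType) (P : R -> R -> Prop) (f g : R -> R -> \bar R)
    (c : R) :
  0 < c -> (forall x y, P x y -> (f x y <= c%:E * g x y)%E) ->
  (forall x y, P x y -> (g x y <= c%:E * f x y)%E) -> asymp P f g.
Proof.
move=> c0 fg gf; exists c => // x y Pxy; split; last exact: fg.
by rewrite lee_pdivrMl //; exact: gf.
Qed.

Lemma lempert_mono (R : realType) n (M N : set 'rV[R[i]]_n.+1) z w :
  (forall x, M x -> N x) -> (lempert N z w <= lempert M z w)%E.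
Proof.
move=> MN; apply: ereal_inf_le_tmp => _ [a [a1 [phi [hphi p0 pa]]] <-].
exists a => //; split=> //; exists phi; split=> // x x1.
by have [? ?] := hphi x x1; split => //; exact: MN.
Qed.

Lemma lempert_ext_mono (R : realType) n (M N : set 'rV[R[i]]_n.+1) m z w :
  (forall x, M x -> N x) -> (lempert_ext N m z w <= lempert_ext M m z w)%E.
Proof.
move=> MN; have chain k : (lempert_chain N k z w <= lempert_chain M k z w)%E.
  apply: le_ereal_inf_tmp => _ [y [yM y0 ym] <-].
  apply: (@le_trans _ _ (\sum_(j < k) lempert N (y j) (y j.+1))%E).
    by apply: ereal_inf_lbound; exists y => //; split => // j /yM; exact: MN.
  by apply: lee_sum => j _; exact: lempert_mono.
case: m => [k|] //=; apply: le_ereal_inf_tmp => _ [k k1 <-].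
by apply: le_trans (chain k); apply: ereal_inf_lbound; exists k.
Qed.

Lemma G_dom_sub_Gt_dom (R : realType) n (mu : R) z : G_dom n mu z -> Gt_dom n mu z.
Proof.
by move=> [zD zG]; split=> //; apply: lt_le_trans zG _; rewrite lerDr powR_ge0.
Qed.

(** The pattern of all the comparisons: f <= g, with an upper bound for g and
    a lower bound for f by the same function X. *)
Lemma asymp_sandwich (R : realType) (P : R -> R -> Prop) (f g : R -> R -> \bar R)
    (X : R -> R -> R) (a C : R) : 0 < a -> 0 < C ->
  (forall x y, P x y -> [/\ 0 <= X x y, (f x y <= g x y)%E,
     (g x y <= (a * X x y)%:E)%E & ((X x y / C)%:E <= f x y)%E]) ->
  [/\ asymp P g f, asymp P f (fun x y => (X x y)%:E)
    & asymp P (fun x y => (X x y)%:E) g].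
Proof.
move=> a0 C0 H; pose c := (1 + a) * (1 + C).
have aC0 := mulr_gt0 a0 C0.
have c0 : 0 < c by rewrite /c; lra.
have XfC x y : P x y -> ((X x y)%:E <= C%:E * f x y)%E.
  move=> /H[X0 _ _ Xf]; apply: le_trans (lee_wpmul2l _ Xf); last first.
    by rewrite lee_fin ltW.
  by rewrite -EFinM lee_fin mulrC divfK // gt_eqF.
have f0 x y : P x y -> (0 <= f x y)%E.
  move=> /H[X0 _ _]; apply: le_trans.
  by rewrite lee_fin divr_ge0 // ltW.
have g0 x y : P x y -> (0 <= g x y)%E.
  by move=> Pxy; have [_ fg _ _] := H x y Pxy; exact: le_trans (f0 _ _ Pxy) fg.
have scale (r : R) (u : \bar R) : r <= c -> (0 <= u)%E -> (r%:E * u <= c%:E * u)%E.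
  by move=> rc u0; apply: lee_wpmul2r => //; rewrite lee_fin.
have Xf x y : P x y -> ((X x y)%:E <= c%:E * f x y)%E.
  move=> Pxy; apply: le_trans (XfC x y Pxy) (scale _ _ _ (f0 _ _ Pxy)).
  rewrite /c; lra.
have gX x y : P x y -> (g x y <= c%:E * (X x y)%:E)%E.
  move=> Pxy; have [X0 _ gX _] := H x y Pxy; apply: (le_trans gX).
  by rewrite EFinM; apply: scale; [rewrite /c; lra | rewrite lee_fin].
have le_scale (u : \bar R) : (0 <= u)%E -> (u <= c%:E * u)%E.
  move=> u0; rewrite -[X in (X <= _)%E]mul1e; apply: scale => //; rewrite /c; lra.
have fc x y : P x y -> (c%:E * f x y <= c%:E * g x y)%E.
  move=> Pxy; have [_ fg _ _] := H x y Pxy.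
  by apply: lee_wpmul2l => //; rewrite lee_fin ltW.
split; apply: (asymp_of_bounds c0) => x y Pxy; have [X0 fg gX' _] := H x y Pxy.
- apply: (le_trans gX'); rewrite EFinM.
  apply: (@le_trans _ _ (a%:E * (C%:E * f x y))%E).
    by apply: lee_wpmul2l (XfC _ _ Pxy); rewrite lee_fin ltW.
  rewrite muleA -EFinM; apply: scale; [rewrite /c; lra | exact: f0].
- exact: le_trans fg (le_scale _ (g0 _ _ Pxy)).
- exact: le_trans fg (gX _ _ Pxy).
- exact: Xf.
- exact: le_trans (Xf _ _ Pxy) (fc _ _ Pxy).
- exact: gX.
Qed.

Lemma ler_pdiv2l (R : realType) (x a b : R) : 0 <= x -> 0 < a -> a <= b -> x / b <= x / a.
Proof.
by move=> x0 a0 ab; apply: ler_wpM2l => //; rewrite lef_pV2 ?posrE // (lt_le_trans a0).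
Qed.

Lemma lempert_Gt_dom_lower (R : realType) n (mu d e : R) : 0 < mu <= 2 ->
  0 < d < e -> e <= 2^-1 ->
  (((e - d) / e `^ pos_part (1 - 1 / (2 * mu)) / (18432 * (1369 * n%:R + 1)))%:E <=
   lempert (Gt_dom n mu) (pt n d) (pt n e))%E.
Proof.
move=> hmu de e2; have /andP[mu0 mu2] := hmu; have /andP[d0 de'] := de.
have e0 : 0 < e by lra.
have mu20 : 0 < 2 * mu by lra.
have n0 := ler0n R n; have c1 : 1 <= 1369 * n%:R + 1 :> R by lra.
rewrite (powR_pos_part e0 mu20); case: ifP => _.
  apply: le_trans (lempert_ge_dist _ _ ord0 (@Gt_dom_in_polydisc R n mu)).
  rewrite (pt_dist n (ltW de')) lee_fin divr1; apply: ler_pdiv2l; lra.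
apply: le_trans (lempert_Gt_dom_ge n hmu de e2); rewrite lee_fin.
rewrite invf_div mulrA; apply: ler_pdiv2l; [|lra|lra].
by apply: divr_ge0; [apply: mulr_ge0; [lra|exact: powR_ge0]|lra].
Qed.

Lemma lempert_ext_Gt_dom_lower (R : realType) n (mu d e : R) m : 0 < mu <= 2 ->
  0 < d < e -> e <= 2^-1 ->
  (((e - d) / e `^ pos_part (1 - 1 / mu) / (18432 * (1369 * n%:R + 1)))%:E <=
   lempert_ext (Gt_dom n mu) m (pt n d) (pt n e))%E.
Proof.
move=> hmu de e2; have /andP[mu0 mu2] := hmu; have /andP[d0 de'] := de.
have e0 : 0 < e by lra.
suff chain k : (((e - d) / e `^ pos_part (1 - 1 / mu) /
    (18432 * (1369 * n%:R + 1)))%:E <=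
    lempert_chain (Gt_dom n mu) k (pt n d) (pt n e))%E.
  case: m => [k|] //=; apply: le_ereal_inf_tmp => _ [k _ <-]; exact: chain.
rewrite (powR_pos_part e0 mu0); case: ifP => _; last first.
  rewrite invf_div mulrA; exact: lempert_chain_Gt_dom_ge.
have n0 := ler0n R n; have c1 : 1 <= 1369 * n%:R + 1 :> R by lra.
apply: le_ereal_inf_tmp => _ [y [yG y0 ym] <-].
apply: le_trans (sum_lempert_ge_dist y k ord0 (@Gt_dom_in_polydisc R n mu)).
rewrite y0 ym (pt_dist n (ltW de')) lee_fin divr1; apply: ler_pdiv2l; lra.
Qed.

Lemma ler_pos_part_powR (R : realType) (mu d e : R) : 0 < mu -> 0 < d < e ->
  e <= 1 -> (e - d) / e `^ pos_part (1 - 1 / mu) <=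
            (e - d) / e `^ pos_part (1 - 1 / (2 * mu)).
Proof.
move=> mu0 /andP[d0 de] e1; have e0 : 0 < e by lra.
apply: ler_pdiv2l; [lra | exact: powR_gt0 | apply: ger_powR; first by rewrite e0].
rewrite /pos_part ge_max !le_max lexx orbT andbT; apply/orP; left.
by rewrite lerD2l lerN2 !mul1r lef_pV2 ?posrE //; lra.
Qed.

Theorem proposition9 (R : realType) (n : nat) (mu : R) (m : option nat)
    (hn : (2 <= n.+1)%N) (hmu : 0 < mu <= 2)
    (hm : if m is Some k then (2 <= k)%N else true) :
  let P := fun delta eps : R => 0 < delta < eps /\ eps <= 2^-1 in
  let lG := fun delta eps : R => lempert (G_dom n mu) (pt n delta) (pt n eps) in
  let lGt := fun delta eps : R => lempert (Gt_dom n mu) (pt n delta) (pt n eps) in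
  let lmG := fun delta eps : R =>
    lempert_ext (G_dom n mu) m (pt n delta) (pt n eps) in
  let lmGt := fun delta eps : R =>
    lempert_ext (Gt_dom n mu) m (pt n delta) (pt n eps) in
  let X := fun delta eps : R => (eps - delta) / eps `^ pos_part (1 - 1 / (2 * mu)) in
  let Y := fun delta eps : R => (eps - delta) / eps `^ pos_part (1 - 1 / mu) in
  [/\ asymp P lG lGt,
      asymp P lGt (fun delta eps => (X delta eps)%:E),
      forall delta eps : R, P delta eps -> X delta eps >= Y delta eps,
      asymp P (fun delta eps => (Y delta eps)%:E) lmG
    & asymp P lmG lmGt].
Proof.
case: n hn => [//|n] _ P lG lGt lmG lmGt X Y.
have /andP[mu0 mu2] := hmu.
pose C : R := 18432 * (1369 * n.+1%:R + 1).
have C0 : 0 < C by have := ler0n R n.+1; rewrite /C; lra.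
have num_ge0 (p d e : R) : P d e -> 0 <= (e - d) / e `^ p.
  by move=> [/andP[_ de] _]; rewrite divr_ge0 ?powR_ge0 // subr_ge0 ltW.
have [lGGt lGtX _] : [/\ asymp P lG lGt, asymp P lGt (fun d e => (X d e)%:E)
    & asymp P (fun d e => (X d e)%:E) lG].
  apply: (@asymp_sandwich R P lGt lG X 32 C) => // d e Pde; have [de e2] := Pde.
  split; first exact: num_ge0.
  - by apply: lempert_mono => z; exact: G_dom_sub_Gt_dom.
  - exact: lempert_G_dom_le.
  - exact: lempert_Gt_dom_lower.
have [lmGGt _ lmGY] : [/\ asymp P lmG lmGt, asymp P lmGt (fun d e => (Y d e)%:E)
    & asymp P (fun d e => (Y d e)%:E) lmG].
  apply: (@asymp_sandwich R P lmGt lmG Y 6 C) => // d e Pde; have [de e2] := Pde.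
  split; first exact: num_ge0.
  - by apply: lempert_ext_mono => z; exact: G_dom_sub_Gt_dom.
  - rewrite /lmG; case: m hm {lmG lmGt} => [[|[|k]]|] // _.
      exact: lempert_chain_G_dom_le.
    apply: (@le_trans _ _ (lempert_chain (G_dom n.+1 mu) 2 (pt n.+1 d) (pt n.+1 e))).
      by apply: ereal_inf_lbound; exists 2%N.
    exact: lempert_chain_G_dom_le.
  - exact: lempert_ext_Gt_dom_lower.
split=> // d e [de e2]; apply: ler_pos_part_powR => //.
by apply: le_trans e2 _; rewrite invf_le1 ?ler1n.
Qed.
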